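(* Let $P=\{p<q\}$ and let $W\in\mathrm{Sam}_P$ be Whitney stratified with $W_p$ compact. Then for any $C>1$ there exists some $R>0$ such that the map $$\mathcal P_v:\mathrm{Sam}_P\to\mathrm{Ho}(\mathrm{Diag}_P^{\mathbb R_+})$$ is $2(C+1)$-Lipschitz continuous at $W$ for all $v\in\Omega\cap(0,R)^2$ (with respect to the interleaving distance on the target).
   Context: Fix $\mathbb R^N$ with Euclidean norm. ''Metric'' means symmetric Lawvere metric (value $\infty$ allowed, distinct elements may have distance $0$). For $A\subset\mathbb R^N$, $\alpha\ge0$: $A_\alpha=\{y\mid\exists x\in A:\|x-y\|\le\alpha\}$. $\mathbb R_+=[0,\infty)$ as a poset. The Hausdorff distance on subsets of $\mathbb R^N$ is $d_{\mathrm{Hd}}(\mathbb X,\mathbb X')=\inf\{\alpha>0\mid\mathbb X\subset\mathbb X'_\alpha,\mathbb X'\subset\mathbb X_\alpha\}$. $\mathrm{Sam}_P$ is the set of pairs $(\mathbb X,\mathbb X_p)$ with $\mathbb X_p\subset\mathbb X\subset\mathbb R^N$ and metric $\max\{d_{\mathrm{Hd}}(\mathbb X,\mathbb X'),d_{\mathrm{Hd}}(\mathbb X_p,\mathbb X'_p)\}$. $\Omega=\{v=(v_l,v_u)\mid 0<v_l<v_u<1\}$. For $S=(X,S_p)\in\mathrm{Sam}_P$ put $s(x)=\min\{d(x,S_p),1\}$ on $X$ ($d(x,\emptyset)=\infty$), $S_{\le a}=s^{-1}[0,a]$, $S^{a}=s^{-1}[a,1]$, $S^a_b=s^{-1}[a,b]$.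 $\mathrm{Top}$ is the category of $\Delta$-generated spaces. $\mathrm{Diag}_P$ is the category of diagrams of spaces $D_p\leftarrow D_{\{p<q\}}\to D_q$; weak equivalences are morphisms that are weak homotopy equivalences at each entry. $\mathrm{Ho}(\mathrm{Diag}_P^{\mathbb R_+})$ is the localization of $\mathrm{Diag}_P^{\mathbb R_+}$ at natural transformations that are weak equivalences at every $\alpha\in\mathbb R_+$. (It is equivalent, via homotopy links, to the persistent homotopy category $\mathrm{Ho}\,\mathrm{Top}_P^{\mathbb R_+}$ of stratified spaces, compatibly with shifts, and the paper identifies the two.) The persistent stratified homotopy type $\mathcal P_v(S)$ is the functor $\alpha\mapsto\{(S_{\le v_u})_\alpha\hookleftarrow(S^{v_l}_{v_u})_\alpha\hookrightarrow(S^{v_l})_\alpha\}$ with structure maps the inclusions, as an object of $\mathrm{Ho}(\mathrm{Diag}_P^{\mathbb R_+})$. Interleaving distance: for $\varepsilon\ge0$ let $Y_\varepsilon(\alpha)=Y(\alpha+\varepsilon)$; this shift and the natural maps $Y\to Y_\varepsilon$ descend to $\mathrm{Ho}(\mathrm{Diag}_P^{\mathbb R_+})$. $Y,Z$ are $\varepsilon$-interleaved if there are morphisms $f:Y\to Z_\varepsilon$, $g:Z\to Y_\varepsilon$ in the homotopy category with $g_\varepsilon\circ f$ and $f_\varepsilon\circ g$ equal to the natural maps $Y\to Y_{2\varepsilon}$, $Z\to Z_{2\varepsilon}$. The distance is the infimum of such $\varepsilon$. A map $f:M\to M'$ of metric spaces is $K$-Lipschitz at $x$ if there is $\delta>0$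 with $d(f(x),f(y))\le K\,d(x,y)$ for all $y$ with $d(x,y)\le\delta$. Whitney stratified over $P=\{p<q\}$: $W=(X,W_p)$ with $X\subset\mathbb R^N$ locally closed, $W_p$ closed in $X$, $W_q=X\setminus W_p$ dense in $X$, $W_p$ and $W_q$ smooth submanifolds of $\mathbb R^N$, and (condition (b)) for sequences $x_n\in W_q$, $y_n\in W_p$ both converging to some $y\in W_p$ such that the lines $\mathrm{span}(x_n-y_n)$ converge to $l$ and $T_{x_n}W_q$ converge to $\tau$, one has $l\subset\tau$. *)

(* Defs.v *)
From HB Require Import structures.
From mathcomp Require Import all_boot all_order all_algebra.
From mathcomp Require Import all_classical all_reals all_analysis.

Set Implicit Arguments.
Unset Strict Implicit.
Unset Printing Implicit Defensive.

Import Order.TTheory GRing.Theory Num.Theory.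
Import numFieldNormedType.Exports.

Local Open Scope classical_set_scope.
Local Open Scope ring_scope.

Record category := Category {
  cob :> Type;
  hom : cob -> cob -> Type;
  idm : forall x, hom x x;
  compm : forall x y z, hom y z -> hom x y -> hom x z;
  compm1 : forall x y (f : hom x y), compm f (idm x) = f;
  comp1m : forall x y (f : hom x y), compm (idm y) f = f;
  compmA : forall x y z t (h : hom z t) (g : hom y z) (f : hom x y),
    compm h (compm g f) = compm (compm h g) f }.

Arguments hom {c} _ _.
Arguments idm {c} _.
Arguments compm {c x y z} _ _.

Record functor (C D : category) := Functor {
  fob :> C -> D;
  fmap : forall x y : C, hom x y -> hom (fob x) (fob y);
  fmap1 : forall x : C, fmap (idm x) = idm (fob x);
  fmapM : forall (x y z : C) (g : hom y z) (f : hom x y),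
    fmap (compm g f) = compm (fmap g) (fmap f) }.

Arguments fmap {C D} _ {x y} _.

Record nattrans (C D : category) (F G : functor C D) := NatTrans {
  ntc :> forall x : C, hom (F x) (G x);
  ntcN : forall (x y : C) (f : hom x y),
    compm (ntc y) (fmap F f) = compm (fmap G f) (ntc x) }.

Lemma nattransP (C D : category) (F G : functor C D) (s t : nattrans F G) :
  (forall x, s x = t x) -> s = t.
Proof.
case: s t => [s sN] [t tN] /= st.
have {}st : s = t by apply: functional_extensionality_dep.
by case: _ / st tN => tN; congr NatTrans; exact: Prop_irrelevance.
Qed.

Section functor_category.
Variables C D : category.

Definition nt_id (F : functor C D) : nattrans F F.
Proof.
by exists (fun x => idm (F x)) => x y f; rewrite comp1m compm1.
Defined.

Definition nt_comp (F G H : functor C D) (t : nattrans G H) (s : nattrans F G) :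
  nattrans F H.
Proof.
exists (fun x => compm (t x) (s x)) => x y f.
by rewrite -compmA ntcN !compmA ntcN.
Defined.

Definition functor_cat : category.
Proof.
apply: (@Category (functor C D) (@nattrans C D) nt_id nt_comp).
- by move=> F G s; apply: nattransP => x; exact: compm1.
- by move=> F G s; apply: nattransP => x; exact: comp1m.
- by move=> F G H K u t s; apply: nattransP => x; exact: compmA.
Defined.

End functor_category.

Definition precomp (C C' D : category) (T : functor C' C) :
  functor (functor_cat C D) (functor_cat C' D).
Proof.
unshelve eapply (@Functor (functor_cat C D) (functor_cat C' D)).
- move=> F; apply: (@Functor C' D (fun x => F (T x))
    (fun x y f => fmap F (fmap T f))) => [x|x y z g f].
  + by rewrite !fmap1.
  + by rewrite !fmapM.
- move=> F G s; exists (fun x => ntc s (T x)) => x y f.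
  exact: (ntcN (s : nattrans F G)).
- by move=> F; exact: nattransP.
- by move=> F G H t s; exact: nattransP.
Defined.

Definition poset_cat (d : Order.disp_t) (P : porderType d) : category.
Proof.
apply: (@Category P (fun a b => (a <= b)%O) (fun a => lexx a)
  (fun a b c bc ab => le_trans ab bc)) => *; exact: Prop_irrelevance.
Defined.

(* The localization of C at the class W (Gabriel and Zisman): same objects, and
   morphisms are the words in the morphisms of C and in formal inverses of
   those in W, modulo the congruence generated by the relations below. *)
Section localization.
Variables (C : category) (W : forall x y : C, hom x y -> Prop).

Inductive word : C -> C -> Type :=
| wfwd x y (f : hom x y) : word x y
| winv x y (w : hom x y) (Ww : W w) : word y x
| wcomp x y z (v : word y z) (u : word x y) : word x z.

Inductive wordeq : forall x y, word x y -> word x y -> Prop :=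
| weq_refl x y (u : word x y) : wordeq u u
| weq_sym x y (u v : word x y) : wordeq u v -> wordeq v u
| weq_trans x y (u v w : word x y) : wordeq u v -> wordeq v w -> wordeq u w
| weq_comp x y z (v v' : word y z) (u u' : word x y) :
    wordeq v v' -> wordeq u u' -> wordeq (wcomp v u) (wcomp v' u')
| weq_assoc x y z t (w : word z t) (v : word y z) (u : word x y) :
    wordeq (wcomp w (wcomp v u)) (wcomp (wcomp w v) u)
| weq_comp1 x y (u : word x y) : wordeq (wcomp u (wfwd (idm x))) u
| weq_1comp x y (u : word x y) : wordeq (wcomp (wfwd (idm y)) u) u
| weq_fwdM x y z (g : hom y z) (f : hom x y) :
    wordeq (wfwd (compm g f)) (wcomp (wfwd g) (wfwd f))
| weq_invl x y (w : hom x y) (Ww : W w) :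
    wordeq (wcomp (winv Ww) (wfwd w)) (wfwd (idm x))
| weq_invr x y (w : hom x y) (Ww : W w) :
    wordeq (wcomp (wfwd w) (winv Ww)) (wfwd (idm y)).

Definition lhom (x y : C) : Type :=
  {A : word x y -> Prop | exists u, A = wordeq u}.

Definition lclass x y (u : word x y) : lhom x y :=
  exist _ (wordeq u) (ex_intro _ u erefl).

Lemma lhom_eq x y (A B : lhom x y) : sval A = sval B -> A = B.
Proof.
by case: A B => [A hA] [B hB] /= AB; subst B; congr exist; exact: Prop_irrelevance.
Qed.

Definition lrepr x y (A : lhom x y) : word x y := projT1 (cid (projT2 A)).

Lemma lclassP x y (u v : word x y) : lclass u = lclass v <-> wordeq u v.
Proof.
split=> [[uv]|uv]; first by rewrite uv; exact: weq_refl.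
apply: lhom_eq; apply: functional_extensionality_dep => w.
apply: propext; split=> h.
- exact: weq_trans (weq_sym uv) h.
- exact: weq_trans uv h.
Qed.

Lemma lreprK x y (A : lhom x y) : lclass (lrepr A) = A.
Proof.
by rewrite /lrepr; case: cid => u /= Au; exact: lhom_eq.
Qed.

Lemma lreprP x y (u : word x y) : wordeq (lrepr (lclass u)) u.
Proof. by apply/lclassP; rewrite lreprK. Qed.

Definition lcomp x y z (B : lhom y z) (A : lhom x y) : lhom x z :=
  lclass (wcomp (lrepr B) (lrepr A)).

Lemma lcompE x y z (v : word y z) (u : word x y) :
  lcomp (lclass v) (lclass u) = lclass (wcomp v u).
Proof. by apply/lclassP; apply: weq_comp; exact: lreprP. Qed.

Definition localization : category.
Proof.
apply: (@Category C lhom (fun x => lclass (wfwd (idm x))) lcomp).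
- move=> x y A; rewrite -(lreprK A) lcompE; apply/lclassP; exact: weq_comp1.
- move=> x y A; rewrite -(lreprK A) lcompE; apply/lclassP; exact: weq_1comp.
- move=> x y z t D B A; rewrite -(lreprK A) -(lreprK B) -(lreprK D) !lcompE.
  apply/lclassP; exact: weq_assoc.
Defined.

Definition loc : functor C localization.
Proof.
apply: (@Functor C localization (fun x => x) (fun x y f => lclass (wfwd f))).
- by [].
- by move=> x y z g f; rewrite /= lcompE; apply/lclassP; exact: weq_fwdM.
Defined.

End localization.

Arguments loc {C} W.

Section localization_map.
Variables (C D : category) (W : forall x y : C, hom x y -> Prop).
Variables (V : forall x y : D, hom x y -> Prop) (F : functor C D).
Hypothesis FW : forall (x y : C) (f : hom x y), W f -> V (fmap F f).

Fixpoint word_map x y (u : word W x y) : word V (F x) (F y) :=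
  match u with
  | wfwd _ _ f => wfwd V (fmap F f)
  | winv _ _ _ Ww => winv (FW Ww)
  | wcomp _ _ _ v u => wcomp (word_map v) (word_map u)
  end.

Lemma word_map_eq x y (u v : word W x y) :
  wordeq u v -> wordeq (word_map u) (word_map v).
Proof.
elim=> {x y u v} /=.
- by move=> *; exact: weq_refl.
- by move=> *; exact: weq_sym.
- by move=> x y u v w _ uv _ vw; exact: weq_trans uv vw.
- by move=> *; exact: weq_comp.
- by move=> *; exact: weq_assoc.
- by move=> *; rewrite fmap1; exact: weq_comp1.
- by move=> *; rewrite fmap1; exact: weq_1comp.
- by move=> *; rewrite fmapM; exact: weq_fwdM.
- by move=> *; rewrite fmap1; exact: weq_invl.
- by move=> *; rewrite fmap1; exact: weq_invr.
Qed.

Definition localization_map : functor (localization W) (localization V).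
Proof.
apply: (@Functor (localization W) (localization V) F
  (fun x y A => lclass (word_map (lrepr A)))).
- move=> x /=; apply/lclassP.
  rewrite -[idm (F x)]fmap1; exact: (word_map_eq (lreprP _)).
- move=> x y z B A; rewrite /= lcompE; apply/lclassP.
  exact: (word_map_eq (lreprP _)).
Defined.

End localization_map.

Section top.
Variable R : realType.

Definition simplex (n : nat) : set 'rV[R]_n.+1 :=
  [set t | (forall i, 0 <= t 0 i) /\ \sum_i t 0 i = 1].
Arguments simplex : clear implicits.

Definition delta_open (X : topologicalType) (U : set X) : Prop :=
  forall (n : nat) (s : simplex n -> X), continuous s -> open (s @^-1` U).

Definition delta_generated (X : topologicalType) : Prop :=
  forall U : set X, delta_open U -> open U.

(* X with its coreflected Delta-generated topology; K selects the reals over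
   which the simplices are taken *)
Definition deltaify (K : realType) (X : Type) : Type := X.

Section deltaify.
Variable X : topologicalType.

Lemma delta_openT : delta_open [set: X].
Proof. by move=> n s _; rewrite preimage_setT; exact: openT. Qed.

Lemma delta_openI : setI_closed (@delta_open X).
Proof.
by move=> U V oU oV n s cs; rewrite preimage_setI; apply: openI;
  [exact: oU|exact: oV].
Qed.

Lemma delta_open_bigcup (I : Type) (f : I -> set X) :
  (forall i, delta_open (f i)) -> delta_open (\bigcup_i f i).
Proof.
move=> of_ n s cs; rewrite preimage_bigcup.
by apply: bigcup_open => i _; exact: of_.
Qed.

HB.instance Definition _ := Choice.copy (deltaify R X) X.
HB.instance Definition _ := isOpenTopological.Build (deltaify R X)
  delta_openT delta_openI delta_open_bigcup.

Lemma deltaify_openE : @open (deltaify R X) = @delta_open X.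
Proof. by []. Qed.

Lemma deltaify_simplexP (n : nat) (s : simplex n -> X) :
  continuous (s : simplex n -> deltaify R X) <-> continuous s.
Proof.
split=> [/continuousP cs|cs]; apply/continuousP => U oU.
- by apply: cs; rewrite deltaify_openE => m t /continuousP; exact.
- by move: oU; rewrite deltaify_openE; exact.
Qed.

Lemma deltaify_generated : delta_generated (deltaify R X).
Proof.
move=> U oU; rewrite deltaify_openE => n s cs.
by apply: oU; exact/deltaify_simplexP.
Qed.

End deltaify.

Lemma deltaify_continuous (X Y : topologicalType) (f : X -> Y) :
  continuous f -> continuous (f : deltaify R X -> deltaify R Y).
Proof.
move=> cf; apply/continuousP => U; rewrite !deltaify_openE => oU n s cs.
by apply: (oU n (f \o s)) => t; apply: continuous_comp; [exact: cs|exact: cf].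
Qed.

Record dspace := DSpace {
  dcarrier :> topologicalType;
  dspaceP : delta_generated dcarrier }.

Definition dtop : category.
Proof.
apply: (@Category dspace (fun X Y : dspace => continuousType X Y)
  (fun X => [the continuousType X X of idfun])
  (fun X Y Z g f => [the continuousType X Z of g \o f])).
- by move=> X Y f; exact/continuousEP.
- by move=> X Y f; exact/continuousEP.
- by move=> X Y Z T h g f; exact/continuousEP.
Defined.

Definition I01 : set R := `[0, 1].

Definition cube (n : nat) : set 'rV[R]_n := [set t | forall i, 0 <= t 0 i <= 1].
Arguments cube : clear implicits.

Definition cube_boundary (n : nat) : set 'rV[R]_n :=
  [set t | exists i, t 0 i = 0 \/ t 0 i = 1].

Definition path_connects (X : topologicalType) (x y : X) : Prop :=
  exists2 g : I01 -> X, continuous g &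
    forall s, (val s = 0 -> g s = x) /\ (val s = 1 -> g s = y).

(* the elements of pi_n (X, x) are the classes of [gloop x] under
   [gloop_homotopic x] *)
Definition gloop (X : topologicalType) (x : X) (n : nat) (a : cube n -> X) :=
  continuous a /\ forall t, cube_boundary (val t) -> a t = x.

Definition gloop_homotopic (X : topologicalType) (x : X) (n : nat)
    (a b : cube n -> X) : Prop :=
  exists2 H : (I01 * cube n)%type -> X, continuous H &
    forall s t, [/\ val s = 0 -> H (s, t) = a t, val s = 1 -> H (s, t) = b t
      & cube_boundary (val t) -> H (s, t) = x].

(* bijective on path components and on all pi_n, n > 0, at all base points *)
Definition weak_homotopy_equiv (X Y : topologicalType) (f : X -> Y) : Prop :=
  [/\ forall x x', path_connects (f x) (f x') -> path_connects x x',
      forall y, exists x, path_connects (f x) y,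
      forall n x (a b : cube n.+1 -> X), gloop x a -> gloop x b ->
        gloop_homotopic (f x) (f \o a) (f \o b) -> gloop_homotopic x a b
    & forall n x (c : cube n.+1 -> Y), gloop (f x) c ->
        exists2 a, gloop x a & gloop_homotopic (f x) (f \o a) c].

Record diagram := Diagram {
  dg_p : dspace;
  dg_pq : dspace;
  dg_q : dspace;
  dg_top : @hom dtop dg_pq dg_p;
  dg_toq : @hom dtop dg_pq dg_q }.

Record diagram_hom (D E : diagram) := DiagramHom {
  dh_p : @hom dtop (dg_p D) (dg_p E);
  dh_pq : @hom dtop (dg_pq D) (dg_pq E);
  dh_q : @hom dtop (dg_q D) (dg_q E);
  dh_top : compm dh_p (dg_top D) = compm (dg_top E) dh_pq;
  dh_toq : compm dh_q (dg_toq D) = compm (dg_toq E) dh_pq }.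

Lemma diagram_homP (D E : diagram) (f g : diagram_hom D E) :
  dh_p f = dh_p g -> dh_pq f = dh_pq g -> dh_q f = dh_q g -> f = g.
Proof.
case: f g => [f1 f2 f3 fp fq] [g1 g2 g3 gp gq] /= e1 e2 e3.
by subst; congr DiagramHom; exact: Prop_irrelevance.
Qed.

Definition diagram_id (D : diagram) : diagram_hom D D.
Proof.
by apply: (@DiagramHom D D (idm _) (idm _) (idm _)); rewrite comp1m compm1.
Defined.

Definition diagram_comp (D E F : diagram) (g : diagram_hom E F)
  (f : diagram_hom D E) : diagram_hom D F.
Proof.
apply: (@DiagramHom D F (compm (dh_p g) (dh_p f)) (compm (dh_pq g) (dh_pq f))
  (compm (dh_q g) (dh_q f))).
- by rewrite -compmA dh_top compmA dh_top -compmA.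
- by rewrite -compmA dh_toq compmA dh_toq -compmA.
Defined.

Definition diag_cat : category.
Proof.
apply: (@Category diagram diagram_hom diagram_id diagram_comp).
- by move=> D E f; apply: diagram_homP; exact: compm1.
- by move=> D E f; apply: diagram_homP; exact: comp1m.
- by move=> D E F G h g f; apply: diagram_homP; exact: compmA.
Defined.

Definition diagram_weq (D E : diagram) (f : diagram_hom D E) : Prop :=
  [/\ weak_homotopy_equiv (dh_p f), weak_homotopy_equiv (dh_pq f)
    & weak_homotopy_equiv (dh_q f)].

Definition Rplus : category := poset_cat {nonneg R}.

Definition pdiag : category := functor_cat Rplus diag_cat.

Definition pdiag_weq (Y Z : pdiag) (f : hom Y Z) : Prop :=
  forall a : {nonneg R}, diagram_weq (ntc f a).

Definition hopdiag : category := localization pdiag_weq.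

Definition translation (e : {nonneg R}) : functor Rplus Rplus.
Proof.
apply: (@Functor Rplus Rplus
  (fun a : {nonneg R} => (a%:num + e%:num)%:nng : Rplus)
  (fun (a b : {nonneg R}) (ab : a <= b) =>
    (lerD ab (lexx e%:num) :
      (a%:num + e%:num)%:nng <= (b%:num + e%:num)%:nng :> {nonneg R})))
  => *; exact: (@Prop_irrelevance (is_true _)).
Defined.

Definition pshift (e : {nonneg R}) : functor pdiag pdiag :=
  precomp diag_cat (translation e).

Lemma pshift_weq (e : {nonneg R}) (Y Z : pdiag) (f : hom Y Z) :
  pdiag_weq f -> pdiag_weq (fmap (pshift e) f).
Proof. by move=> wf a; exact: wf. Qed.

Definition hoshift (e : {nonneg R}) : functor hopdiag hopdiag :=
  localization_map (pshift_weq e).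

Lemma le_translation2 (e a : {nonneg R}) :
  a <= translation e (translation e a) :> {nonneg R}.
Proof. by rewrite -num_le /= -addrA lerDl addr_ge0. Qed.

(* The natural map from Y to Y_(2e): its target is written (Y_e)_e, whose value
   at a is Y (a + e + e), so that it composes with shifted morphisms. *)
Definition pshift2_map (e : {nonneg R}) (Y : pdiag) :
  @hom pdiag Y (pshift e (pshift e Y)).
Proof.
exists (fun a : Rplus => fmap Y (le_translation2 e a : @hom Rplus _ _)).
move=> a b ab; apply: etrans (esym (fmapM _ _ _)) _.
apply: etrans (fmapM _ _ _); congr fmap.
exact: (@Prop_irrelevance (is_true _)).
Defined.

Definition interleaved (e : {nonneg R}) (Y Z : hopdiag) : Prop :=
  exists (f : hom Y (hoshift e Z)) (g : hom Z (hoshift e Y)),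
    compm (fmap (hoshift e) g) f = fmap (loc pdiag_weq) (pshift2_map e Y) /\
    compm (fmap (hoshift e) f) g = fmap (loc pdiag_weq) (pshift2_map e Z).

Definition interleaving_dist (Y Z : hopdiag) : \bar R :=
  ereal_inf [set (e%:num)%:E | e in [set e : {nonneg R} | interleaved e Y Z]].

End top.

Arguments interleaving_dist {R} Y Z.

Section samples.
Variables (R : realType) (N : nat).
Local Notation E := 'rV[R]_N.

(* The library norm on row vectors is the maximum norm, whose topology is the
   one of the Euclidean norm. *)
Definition enorm (x : E) : R := Num.sqrt (\sum_i x 0 i ^+ 2).

Definition thicken (A : set E) (a : R) : set E :=
  [set y | exists2 x, A x & enorm (x - y) <= a].

Definition hausdorff_dist (A B : set E) : \bar R :=
  ereal_inf [set a%:E | a in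
    [set a : R | [/\ 0 < a, A `<=` thicken B a & B `<=` thicken A a]]].

Record sam := Sam {
  sam_X : set E;
  sam_p : set E;
  sam_pX : sam_p `<=` sam_X }.

Definition sam_q (S : sam) : set E := sam_X S `\` sam_p S.

Definition sam_dist (S T : sam) : \bar R :=
  maxe (hausdorff_dist (sam_X S) (sam_X T)) (hausdorff_dist (sam_p S) (sam_p T)).

Definition dist_set (x : E) (A : set E) : \bar R :=
  ereal_inf [set (enorm (x - y))%:E | y in A].

Definition strat_fun (S : sam) (x : E) : \bar R :=
  mine (dist_set x (sam_p S)) 1%E.

Definition sub_le (S : sam) (a : R) : set E :=
  [set x | sam_X S x /\ (0 <= strat_fun S x <= a%:E)%E].

Definition sub_ge (S : sam) (a : R) : set E :=
  [set x | sam_X S x /\ (a%:E <= strat_fun S x <= 1)%E].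

Definition sub_between (S : sam) (a b : R) : set E :=
  [set x | sam_X S x /\ (a%:E <= strat_fun S x <= b%:E)%E].

Lemma strat_fun_ge0 (S : sam) (x : E) : (0 <= strat_fun S x)%E.
Proof.
rewrite /strat_fun le_min lee01 andbT; apply: le_ereal_inf_tmp => _ [y _ <-].
by rewrite lee_fin sqrtr_ge0.
Qed.

Lemma strat_fun_le1 (S : sam) (x : E) : (strat_fun S x <= 1)%E.
Proof. by rewrite /strat_fun ge_min lexx orbT. Qed.

Lemma sub_between_le (S : sam) (a b : R) : sub_between S a b `<=` sub_le S b.
Proof. by move=> x [Xx /andP[_ xb]]; split=> //; rewrite strat_fun_ge0. Qed.

Lemma sub_between_ge (S : sam) (a b : R) : sub_between S a b `<=` sub_ge S a.
Proof. by move=> x [Xx /andP[ax _]]; split=> //; rewrite ax strat_fun_le1. Qed.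

Lemma thicken_sub (A B : set E) (a b : R) :
  A `<=` B -> a <= b -> thicken A a `<=` thicken B b.
Proof. by move=> AB ab y [x Ax xy]; exists x; [exact: AB|exact: le_trans ab]. Qed.

(* A subset of R^N as an object of the category of Delta-generated spaces: its
   subspace topology need not be Delta-generated. *)
Definition subset_space (A : set E) : dspace R :=
  DSpace (@deltaify_generated R (set_type A)).

Definition incl_fun (A B : set E) (AB : A `<=` B) (x : A) : B :=
  exist _ (val x) (mem_set (AB _ (set_valP x))).
Arguments incl_fun {A B} AB x.

Lemma incl_fun_continuous (A B : set E) (AB : A `<=` B) :
  continuous (incl_fun AB).
Proof.
apply/continuousP => _ [U oU <-].
by rewrite -comp_preimage; exists U.
Qed.

Arguments incl_fun_continuous {A B} AB x.

Definition incl (A B : set E) (AB : A `<=` B) :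
  @hom (dtop R) (subset_space A) (subset_space B) :=
  mkcts (deltaify_continuous (incl_fun_continuous AB)).

Arguments incl {A B} AB.

Lemma incl_id (A : set E) (AA : A `<=` A) : incl AA = idm _.
Proof. by apply/continuousEP => x; exact: val_inj. Qed.

Definition strat_diagram (v : R * R) (S : sam) (a : {nonneg R}) : diagram R :=
  @Diagram R (subset_space (thicken (sub_le S v.2) a%:num))
    (subset_space (thicken (sub_between S v.1 v.2) a%:num))
    (subset_space (thicken (sub_ge S v.1) a%:num))
    (incl (thicken_sub (@sub_between_le S v.1 v.2) (lexx a%:num)))
    (incl (thicken_sub (@sub_between_ge S v.1 v.2) (lexx a%:num))).

Definition strat_diagram_map (v : R * R) (S : sam) (a b : {nonneg R})
  (ab : a <= b) : diagram_hom (strat_diagram v S a) (strat_diagram v S b).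
Proof.
apply: (@DiagramHom R (strat_diagram v S a) (strat_diagram v S b)
  (incl (thicken_sub (@subset_refl _ _) ab))
  (incl (thicken_sub (@subset_refl _ _) ab))
  (incl (thicken_sub (@subset_refl _ _) ab))).
- by apply/continuousEP => x; exact: val_inj.
- by apply/continuousEP => x; exact: val_inj.
Defined.

(* v = (v_l, v_u) *)
Definition persistent_strat (v : R * R) (S : sam) : hopdiag R.
Proof.
apply: (@Functor (Rplus R) (diag_cat R) (strat_diagram v S)
  (@strat_diagram_map v S)).
- by move=> a; apply: diagram_homP; exact: incl_id.
- by move=> a b c bc ab; apply: diagram_homP; apply/continuousEP => x;
    exact: val_inj.
Defined.

End samples.

Definition Omega (R : realType) : set (R * R) :=
  [set v | [/\ 0 < v.1, v.1 < v.2 & v.2 < 1]].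

Definition lipschitz_at (R : realType) (M M' : Type) (d : M -> M -> \bar R)
    (d' : M' -> M' -> \bar R) (K : R) (f : M -> M') (x : M) : Prop :=
  exists2 delta : R, 0 < delta &
    forall y, (d x y <= delta%:E -> d' (f x) (f y) <= K%:E * d x y)%E.

Section whitney.
Variables (R : realType).

(* For finite-dimensional V: class C^k on the open set U, by iterated
   directional derivatives. *)
Fixpoint class_C (V W : normedModType R) (k : nat) (U : set V) (f : V -> W) :
    Prop :=
  (forall x, U x -> {for x, continuous f}) /\
  if k is k'.+1 then
    forall v, (forall x, U x -> derivable f x v) /\
      class_C k' U (fun x => 'D_v f x)
  else True.

Definition smooth_on (V W : normedModType R) (U : set V) (f : V -> W) : Prop :=
  forall k, class_C k U f.

Variable N : nat.
Local Notation E := 'rV[R]_N.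

(* U and V are open, and phi : U -> V is a smooth diffeomorphism that maps the
   points of M in U to those of R^k * 0 in V. *)
Definition slice_chart (M : set E) (k : nat) (U V : set E)
    (phi psi : E -> E) : Prop :=
  [/\ open U /\ open V,
      smooth_on U phi /\ smooth_on V psi,
      forall y, U y -> V (phi y) /\ psi (phi y) = y,
      forall z, V z -> U (psi z) /\ phi (psi z) = z
    & forall y, U y -> (M y <-> forall i : 'I_N, (k <= i)%N -> phi y 0 i = 0)].

(* the dimension k may depend on the connected component *)
Definition submanifold (M : set E) : Prop :=
  forall x, M x -> exists k U V phi psi,
    [/\ (k <= N)%N, U x & slice_chart M k U V phi psi].

Definition tangent_space (M : set E) (x : E) : set E :=
  [set v | exists (c : R -> E) (e : R),
    [/\ 0 < e, smooth_on [set t | - e < t < e] c,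
        forall t, - e < t < e -> M (c t),
        c 0 = x & 'D_1 c 0 = v]].

Definition orthogonal_projector (P : 'M[R]_N) (L : set E) : Prop :=
  [/\ P^T = P, P *m P = P & L = [set v | v *m P = v]].

(* Convergence in the Grassmannian, with the topology in which a linear subspace
   is identified with its orthogonal projector. *)
Definition subspace_cvg (L : nat -> set E) (L' : set E) : Prop :=
  exists (P : nat -> 'M[R]_N) (P' : 'M[R]_N),
    [/\ forall n, orthogonal_projector (P n) (L n),
        orthogonal_projector P' L'
      & P n @[n --> \oo] --> P'].

Definition line (u : E) : set E := [set c *: u | c in [set: R]].

Definition whitney_b (Mq Mp : set E) : Prop :=
  forall (x y : nat -> E) (y0 : E) (l tau : set E),
    (forall n, Mq (x n)) -> (forall n, Mp (y n)) -> Mp y0 ->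
    x n @[n --> \oo] --> y0 -> y n @[n --> \oo] --> y0 ->
    subspace_cvg (fun n => line (x n - y n)) l ->
    subspace_cvg (fun n => tangent_space Mq (x n)) tau ->
    l `<=` tau.

Definition locally_closed (A : set E) : Prop :=
  exists U F : set E, [/\ open U, closed F & A = U `&` F].

Definition whitney_stratified (S : sam R N) : Prop :=
  [/\ locally_closed (sam_X S),
      exists2 F : set E, closed F & sam_p S = sam_X S `&` F,
      sam_X S `<=` closure (sam_q S),
      submanifold (sam_p S) /\ submanifold (sam_q S)
    & whitney_b (sam_q S) (sam_p S)].

End whitney.

(* Main.v *)
Require Import Defs.
From HB Require Import structures.
From mathcomp Require Import all_boot all_order all_algebra.
From mathcomp Require Import all_classical all_reals all_analysis.
From mathcomp Require Import ring lra.

Set Implicit Arguments.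
Unset Strict Implicit.
Unset Printing Implicit Defensive.

Import Order.TTheory GRing.Theory Num.Theory.
Import numFieldNormedType.Exports.

Local Open Scope classical_set_scope.
Local Open Scope ring_scope.

(** The idea is that the three spaces of the persistent stratified homotopy type
    change little, in the Hausdorff sense, when the sample does: if each of the three
    sets that are thickened for [W] lies in the [e]-thickening of the corresponding set
    for [S] and conversely, then inclusions give an [e]-interleaving already on the
    level of diagrams of spaces ([interleaved_thicken]).  So it suffices to find, for
    [eps] slightly larger than the distance of [W] and [S], such inclusions with
    [e = (2 C + 1) eps] ([sub_between_thicken]).

    A point of one sample has a point of the other one within [eps], and the distances
    of the two points to the lower strata differ by at most [2 eps].  The second point
    may thus violate the bounds [v_l] and [v_u] by [2 eps], and has to be moved inside
    [W] to a point that satisfies them.  This costs at most [2 C eps] because, close to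
    [W_p], every point of [W] outside of [W_p] can be moved inside [W] to any
    prescribed small distance from [W_p] at a cost of at most [C] per unit of distance
    gained or lost ([whitney_move]).

    This follows from an infinitesimal statement ([whitney_slopes]): the distance is
    maximized, over a compact set, among the points that are reachable at that cost,
    and a maximizer below the prescribed level could be improved ([reach_level]).

    The infinitesimal statement comes from Whitney's condition (b).  By compactness, if
    [x] in the open stratum is close to a point [p] of [W_p], then some tangent vector
    [h] at [x] of norm at most 1 has a component along [x - p] that is as close to 1 as
    desired ([whitney_b_tangent_secant]).  With [p] nearest to [x], going from [x] in the
    direction [- h] decreases the distance to [p], and hence the one to [W_p], at
    almost unit speed.  In the direction [h] one has to make sure that the distance to
    all points of [W_p] that are almost nearest to [x] increases; this holds since all
    of them are close to [p], compared to the distance from [x] to [W_p]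
    ([almost_nearest_close]).  The reason is that at small scales [W_p] is almost convex
    ([submanifold_nearly_convex]), which makes it uniformly almost orthogonal to
    [x - p] near [p] ([nearest_almost_normal]). *)

(** * Euclidean geometry of row vectors *)

Section euclidean.
Variables (R : realType) (N : nat).
Implicit Types (x y z : 'rV[R]_N) (a : R).

Definition dot x y : R := (x *m y^T) 0 0.

Lemma dotE x y : dot x y = \sum_i x 0 i * y 0 i.
Proof. by rewrite /dot mxE; apply: eq_bigr => i _; rewrite mxE. Qed.

Lemma dotC x y : dot x y = dot y x.
Proof. by rewrite !dotE; apply: eq_bigr => i _; rewrite mulrC. Qed.

Lemma dotDl x y z : dot (x + y) z = dot x z + dot y z.
Proof. by rewrite /dot mulmxDl mxE. Qed.

Lemma dotNl x y : dot (- x) y = - dot x y.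
Proof. by rewrite /dot mulNmx mxE. Qed.

Lemma dotBl x y z : dot (x - y) z = dot x z - dot y z.
Proof. by rewrite dotDl dotNl. Qed.

Lemma dotZl a x y : dot (a *: x) y = a * dot x y.
Proof. by rewrite /dot -scalemxAl mxE. Qed.

Lemma dot0l x : dot 0 x = 0.
Proof. by rewrite /dot mul0mx mxE. Qed.

Lemma dotDr x y z : dot z (x + y) = dot z x + dot z y.
Proof. by rewrite dotC dotDl !(dotC z). Qed.

Lemma dotNr x y : dot x (- y) = - dot x y.
Proof. by rewrite dotC dotNl (dotC x). Qed.

Lemma dotBr x y z : dot z (x - y) = dot z x - dot z y.
Proof. by rewrite dotDr dotNr. Qed.

Lemma dotZr a x y : dot x (a *: y) = a * dot x y.
Proof. by rewrite dotC dotZl dotC. Qed.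

Lemma dotxx_ge0 x : 0 <= dot x x.
Proof. by rewrite dotE sumr_ge0// => i _; rewrite -expr2 sqr_ge0. Qed.

Lemma enormE x : enorm x = Num.sqrt (dot x x).
Proof. by congr Num.sqrt; rewrite dotE; apply: eq_bigr => i _; rewrite expr2. Qed.

Lemma enorm_ge0 x : 0 <= enorm x.
Proof. exact: sqrtr_ge0. Qed.

Lemma enorm_sqr x : enorm x ^+ 2 = dot x x.
Proof. by rewrite enormE sqr_sqrtr// dotxx_ge0. Qed.

Lemma enormN x : enorm (- x) = enorm x.
Proof. by rewrite !enormE dotNl dotNr opprK. Qed.

Lemma enormBC x y : enorm (x - y) = enorm (y - x).
Proof. by rewrite -enormN opprB. Qed.

Lemma enormZ a x : enorm (a *: x) = `|a| * enorm x.
Proof.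
by rewrite !enormE dotZl dotZr mulrA -expr2 sqrtrM ?sqr_ge0// sqrtr_sqr.
Qed.

Lemma enorm0 : enorm (0 : 'rV[R]_N) = 0.
Proof. by rewrite -(scale0r 0) enormZ normr0 mul0r. Qed.

Lemma normr_coord_le m n (M : 'M[R]_(m, n)) i j : `|M i j| <= `|M|.
Proof. by rewrite [leRHS]/Num.norm/= mx_normrE; exact: (le_bigmax _ _ (i, j)). Qed.

Lemma normr_mx_le m n (M : 'M[R]_(m, n)) a :
  0 <= a -> (forall i j, `|M i j| <= a) -> `|M| <= a.
Proof.
by move=> a0 Ma; rewrite [leLHS]/Num.norm/= mx_normrE bigmax_le// => -[i j] _.
Qed.

Lemma normr_le_enorm x : `|x| <= enorm x.
Proof.
apply: normr_mx_le (enorm_ge0 x) _ => i j; rewrite ord1 -sqrtr_sqr.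
rewrite ler_wsqrtr// (bigD1 j)//= lerDl sumr_ge0// => k _; exact: sqr_ge0.
Qed.

Lemma enorm_le_normr x : enorm x <= N.+1%:R * `|x|.
Proof.
rewrite -[leRHS]ger0_norm ?mulr_ge0// -sqrtr_sqr ler_wsqrtr//.
rewrite (@le_trans _ _ (\sum_(i < N) `|x| ^+ 2))//.
  apply: ler_sum => i _; rewrite -real_normK ?num_real//.
  by rewrite lerXn2r ?nnegrE// normr_coord_le.
rewrite sumr_const card_ord -[leLHS]mulr_natl exprMn ler_wpM2r ?sqr_ge0//.
by rewrite -natrX ler_nat (leq_trans (leqnSn N))// leq_pmulr.
Qed.

Lemma enorm_eq0 x : (enorm x == 0) = (x == 0).
Proof.
apply/eqP/eqP => [x0|->]; last exact: enorm0.
by apply/eqP; rewrite -normr_le0 -x0 normr_le_enorm.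
Qed.

Lemma enorm_gt0 x : (0 < enorm x) = (x != 0).
Proof. by rewrite lt_def enorm_ge0 andbT enorm_eq0. Qed.

Lemma cauchy_schwarz x y : dot x y <= enorm x * enorm y.
Proof.
have [->|y0] := eqVneq y 0.
  by rewrite enorm0 mulr0 dotC dot0l.
have yy : 0 < enorm y by rewrite enorm_gt0.
have := dotxx_ge0 (enorm y ^+ 2 *: x - dot x y *: y).
rewrite !(dotBl, dotBr, dotZl, dotZr) (dotC y x) -!enorm_sqr => h.
have {}h : 0 <= enorm y ^+ 2 * ((enorm x * enorm y) ^+ 2 - dot x y ^+ 2).
  by rewrite (le_trans h)// le_eqVlt; apply/orP; left; apply/eqP; ring.
rewrite pmulr_rge0 ?exprn_gt0// subr_ge0 in h.
rewrite (le_trans (ler_norm _))// -[leRHS]ger0_norm ?mulr_ge0 ?enorm_ge0//.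
by rewrite -ler_sqr ?nnegrE// !real_normK ?num_real.
Qed.

Lemma normr_dot x y : `|dot x y| <= enorm x * enorm y.
Proof.
rewrite ler_norml cauchy_schwarz andbT lerNl -dotNl -(enormN x).
exact: cauchy_schwarz.
Qed.

Lemma ler_enormD x y : enorm (x + y) <= enorm x + enorm y.
Proof.
rewrite -ler_sqr ?nnegrE ?addr_ge0 ?enorm_ge0// enorm_sqr.
rewrite !(dotDl, dotDr) (dotC y x) sqrrD -!enorm_sqr.
have := cauchy_schwarz x y; lra.
Qed.

Lemma ler_enorm_distD z x y : enorm (x - y) <= enorm (x - z) + enorm (z - y).
Proof. by rewrite -[x - y](subrKA z) ler_enormD. Qed.

Lemma enorm_sqrB x y :
  enorm (x - y) ^+ 2 = enorm x ^+ 2 - 2 * dot x y + enorm y ^+ 2.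
Proof. by rewrite !enorm_sqr !(dotBl, dotBr) (dotC y x); ring. Qed.

Lemma enorm_cvg (T : Type) (F : set_system T) {FF : Filter F}
    (f : T -> 'rV[R]_N) (l : 'rV[R]_N) :
  f @ F --> l -> forall e, 0 < e -> \forall t \near F, enorm (f t - l) < e.
Proof.
move=> fl e e0; have e'0 : 0 < e / N.+1%:R by rewrite divr_gt0.
have /cvgrPdist_lt/(_ _ e'0) := fl; apply: filterS => t.
rewrite distrC ltr_pdivlMr// mulrC; apply: le_lt_trans; exact: enorm_le_normr.
Qed.

Lemma enorm_continuous y : continuous (fun x => enorm (x - y)).
Proof.
move=> x; apply/(@cvgrPdist_lt _ _ _ (nbhs x) (nbhs_filter x)) => e e0.
have := @enorm_cvg _ (nbhs x) (nbhs_filter x) id x (@cvg_id _ _) e e0.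
apply: filterS => z.
apply: le_lt_trans; rewrite ler_norml.
have := ler_enorm_distD z x y; have := ler_enorm_distD x z y.
by rewrite (enormBC x z) => *; apply/andP; split; lra.
Qed.

End euclidean.

(** * Strict differentiability of maps of class C^1 *)

Section strict_differentiability.
Variable R : realType.

Lemma is_derive_line n m (f : 'rV[R]_n -> 'rV[R]_m) (x e : 'rV[R]_n) (s : R)
    (j : 'I_m) :
  derivable f (x + s *: e) e ->
  is_derive s 1 (fun t : R => f (x + t *: e) 0 j) ('D_e f (x + s *: e) 0 j).
Proof.
move=> df.
have dq : derivable (fun t : R => f (x + t *: e)) s 1 /\
    'D_1 (fun t : R => f (x + t *: e)) s = 'D_e f (x + s *: e).
  rewrite /derivable /derive.
  suff -> : (fun h : R => h^-1 *: (((fun t : R => f (x + t *: e)) \o shift s)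
        (h *: 1) - f (x + s *: e))) =
      (fun h => h^-1 *: ((f \o shift (x + s *: e)) (h *: e)
        - f (x + s *: e))) by [].
  apply/funext => h /=; congr (_ *: (f _ - _)).
  by rewrite [h%:A]mulr1 scalerDl addrCA addrA.
case: dq => dq dqE; rewrite -dqE; split; first by move/derivable_mxP: dq; exact.
by rewrite derive_mx// mxE.
Qed.

Lemma increment_line_ge0 n m (f : 'rV[R]_n -> 'rV[R]_m) (x e : 'rV[R]_n) (tau : R)
    (d : 'rV[R]_m) (eta : R) :
  0 <= tau ->
  (forall s, 0 <= s <= tau -> derivable f (x + s *: e) e /\
    `|'D_e f (x + s *: e) - d| <= eta) ->
  `|f (x + tau *: e) - f x - tau *: d| <= eta * tau.
Proof.
move=> tau0 H.
have eta0 : 0 <= eta.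
  by apply: le_trans (H 0 _).2; rewrite ?normr_ge0// lexx.
apply: normr_mx_le => [|i j]; first exact: mulr_ge0.
rewrite ord1 !mxE.
pose g (t : R) : R := f (x + t *: e) 0 j.
pose dg (s : R) : R := 'D_e f (x + s *: e) 0 j.
have gP (s : R) : s \in `[0, tau]%R -> is_derive s 1 g (dg s).
  by rewrite in_itv/= => /H[? _]; exact: is_derive_line.
have gP' (s : R) : s \in `]0, tau[%R -> is_derive s 1 g (dg s).
  by move=> s0; apply: gP; exact: subset_itv_oo_cc s0.
have gc : {within `[0, tau], continuous g}.
  apply: derivable_within_continuous => s s0.
  exact: (@ex_derive _ _ _ _ _ _ _ (gP s s0)).
have [c] := MVT_segment tau0 gP' gc.
rewrite /g /dg; rewrite in_itv/= scale0r addr0 subr0 => /H[_ cd] ->.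
rewrite (mulrC tau) -mulrBl normrM (ger0_norm tau0) ler_wpM2r//.
rewrite (le_trans _ cd)//.
by have := normr_coord_le ('D_e f (x + c *: e) - d) 0 j; rewrite !mxE.
Qed.

Lemma increment_line n m (f : 'rV[R]_n -> 'rV[R]_m) (x e : 'rV[R]_n) (tau : R)
    (d : 'rV[R]_m) (eta : R) :
  (forall s, 0 <= s <= 1 -> derivable f (x + (s * tau) *: e) e /\
    `|'D_e f (x + (s * tau) *: e) - d| <= eta) ->
  `|f (x + tau *: e) - f x - tau *: d| <= eta * `|tau|.
Proof.
move=> H; have [tau0|tau0] := leP 0 tau.
  rewrite ger0_norm//; apply: increment_line_ge0 => // s /andP[s0 st].
  have [t0|t0] := eqVneq tau 0.
    have s00 : s = 0 by apply/eqP; rewrite eq_le s0 -t0 st.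
    by have := H 0; rewrite mul0r s00; apply; rewrite lexx ler01.
  have t1 : 0 < tau by rewrite lt_def t0.
  have := H (s / tau); rewrite divfK//; apply.
  by rewrite divr_ge0//= ler_pdivrMr// mul1r.
have := @increment_line_ge0 n m f (x + tau *: e) e (- tau) d eta.
rewrite oppr_ge0 (ltW tau0) ltr0_norm// => /(_ isT) H'.
rewrite -normrN !opprD !opprK (addrC (- _)).
move: H'; rewrite scaleNr addrK scaleNr opprK; apply.
move=> s /andP[s0 st]; rewrite -addrA -scalerDl.
have -> : tau + s = (1 - s / - tau) * tau.
  by rewrite invrN mulrN opprK mulrDl mul1r divfK// lt_eqF.
have t1 : 0 < - tau by rewrite oppr_gt0.
apply: H; rewrite subr_ge0 ler_pdivrMr// mul1r st/= gerBl.
by rewrite divr_ge0// ltW.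
Qed.

(** Walking from [a] to [b] along the coordinate axes reduces the estimate to the
    mean value theorem for the partial derivatives, which are close to their values
    at [x0]. *)
Lemma C1_strictly_differentiable n m (U : set 'rV[R]_n)
    (f : 'rV[R]_n -> 'rV[R]_m) (x0 : 'rV[R]_n) :
  open U -> U x0 -> class_C 1 U f ->
  exists J : 'M[R]_(n, m), forall eta, 0 < eta ->
    exists2 delta, 0 < delta & forall a b, `|a - x0| < delta ->
      `|b - x0| < delta -> `|f b - f a - (b - a) *m J| <= eta * `|b - a|.
Proof.
move=> oU Ux0 [_ Cf].
pose D (i : 'I_n) x := 'D_(delta_mx 0 i) f x.
exists (\matrix_i D i x0) => eta eta0.
pose eta' := eta / n.+1%:R.
have eta'0 : 0 < eta' by rewrite divr_gt0.
have : \forall x \near x0, U x /\ forall i : 'I_n, `|D i x - D i x0| <= eta'.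
  apply: filterI; first exact: open_nbhs_nbhs.
  apply: (@filter_forall _ _ _ (nbhs x0) (nbhs_filter x0)) => i.
  have [_ [Dc _]] := Cf (delta_mx 0 i).
  exact: cvgr_distC_le (Dc _ Ux0) _ eta'0.
move=> /nbhs_ballP[delta /= delta0 xP]; exists delta => // a b ax bx.
have {}xP x : `|x - x0| < delta ->
    U x /\ forall i : 'I_n, `|D i x - D i x0| <= eta'.
  by move=> xx; apply: xP; rewrite -ball_normE/= distrC.
(* z k has the first k coordinates of b and the other ones of a *)
pose z k : 'rV[R]_n := \row_i (if (i < k)%N then b 0 i else a 0 i).
have z0 : z 0%N = a by apply/rowP => i; rewrite mxE.
have zn : z n = b by apply/rowP => i; rewrite mxE ltn_ord.
have zS (i : 'I_n) (s : R) : `|z i + (s * (b 0 i - a 0 i)) *: delta_mx 0 i - x0|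
    < delta \/ ~ 0 <= s <= 1.
  have [/andP[s0 s1]|] := boolP (0 <= s <= 1); last by move/negP; right.
  left; apply: le_lt_trans (_ : Num.max `|a - x0| `|b - x0| < _); last first.
    by rewrite gt_max ax.
  have ca j : `|a 0 j - x0 0 j| <= Num.max `|a - x0| `|b - x0|.
    have := normr_coord_le (a - x0) 0 j; rewrite !mxE => h.
    by rewrite le_max h.
  have cb j : `|b 0 j - x0 0 j| <= Num.max `|a - x0| `|b - x0|.
    have := normr_coord_le (b - x0) 0 j; rewrite !mxE => h.
    by rewrite le_max h orbT.
  apply: normr_mx_le => [|k j]; first by rewrite le_max normr_ge0.
  rewrite ord1 !mxE eqxx/=; have [->|ji] := eqVneq j i.
    rewrite ltnn mulr1; set c := Num.max _ _ in ca cb *.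
    have := ca i; have := cb i; rewrite !ler_norml => /andP[? ?] /andP[? ?].
    have ->: a 0 i + s * (b 0 i - a 0 i) - x0 0 i =
      (1 - s) * (a 0 i - x0 0 i) + s * (b 0 i - x0 0 i) by ring.
    by apply/andP; split; nra.
  by rewrite mulr0 addr0; case: ifP.
have zD (i : 'I_n) : z i.+1 = z i + (b 0 i - a 0 i) *: delta_mx 0 i.
  apply/rowP => j; rewrite !mxE eqxx/= ltnS.
  have [->|ji] := eqVneq j i; first by rewrite leqnn ltnn mulr1 addrC subrK.
  by rewrite mulr0 addr0 leq_eqVlt (negbTE (ji : val j != val i)).
have -> : f b - f a - (b - a) *m (\matrix_i D i x0) =
    \sum_(i < n) (f (z i.+1) - f (z i) - (b 0 i - a 0 i) *: D i x0).
  rewrite sumrB; congr (_ - _).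
    by rewrite -(big_mkord xpredT (fun i => f (z i.+1) - f (z i)))
      telescope_sumr// zn z0.
  by rewrite mulmx_sum_row; apply: eq_bigr => i _; rewrite rowK !mxE.
apply: le_trans (ler_norm_sum _ _ _) _.
apply: (@le_trans _ _ (\sum_(i < n) eta' * `|b - a|)).
  apply: ler_sum => i _; rewrite zD.
  apply: (@le_trans _ _ (eta' * `|b 0 i - a 0 i|)).
    apply: increment_line => s s01.
    have [/xP[Uz Dz]|//] := zS i s.
    split; last exact: Dz.
    by have [+ _] := Cf (delta_mx 0 i); exact.
  rewrite ler_wpM2l ?(ltW eta'0)//.
  by have := normr_coord_le (b - a) 0 i; rewrite !mxE.
rewrite sumr_const card_ord -[leLHS]mulr_natl mulrA ler_wpM2r//.
rewrite /eta' mulrCA ler_piMr ?(ltW eta0)// ler_pdivrMr// mul1r ler_nat.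
exact: leqnSn.
Qed.

End strict_differentiability.

(** * Submanifolds at small scales *)

Section submanifolds.
Variable R : realType.

Lemma normr_mulmx_le m n (v : 'rV[R]_m) (J : 'M[R]_(m, n)) :
  `|v *m J| <= m%:R * `|J| * `|v|.
Proof.
apply: normr_mx_le => [|i j]; first by rewrite !mulr_ge0.
rewrite mxE (le_trans (ler_norm_sum _ _ _))//.
apply: (@le_trans _ _ (\sum_(k < m) `|J| * `|v|)).
  by apply: ler_sum => k _; rewrite normrM mulrC ler_pM ?normr_coord_le.
by rewrite sumr_const card_ord -[leLHS]mulr_natl mulrA.
Qed.

Lemma C1_lipschitz n m (U : set 'rV[R]_n) (f : 'rV[R]_n -> 'rV[R]_m)
    (x0 : 'rV[R]_n) :
  open U -> U x0 -> class_C 1 U f ->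
  exists2 L, 0 < L & exists2 delta, 0 < delta & forall a b,
    `|a - x0| < delta -> `|b - x0| < delta -> `|f b - f a| <= L * `|b - a|.
Proof.
move=> oU Ux0 /(C1_strictly_differentiable oU Ux0)[J /(_ _ ltr01)[delta d0 Jf]].
exists (1 + n%:R * `|J|); first by rewrite ltr_pwDl// mulr_ge0.
exists delta => // a b ad bd; rewrite -(subrK ((b - a) *m J) (f b - f a)).
by rewrite (le_trans (ler_normD _ _))// mulrDl lerD ?Jf ?normr_mulmx_le.
Qed.

Lemma C1_differentiable n m (U : set 'rV[R]_n) (f : 'rV[R]_n -> 'rV[R]_m)
    (x0 : 'rV[R]_n) :
  open U -> U x0 -> class_C 1 U f -> differentiable f x0.
Proof.
move=> oU Ux0 /(C1_strictly_differentiable oU Ux0)[J Jf].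
have Jc : continuous (mulmxr J : {linear 'rV[R]_n -> 'rV[R]_m}).
  apply: (@bounded_linear_continuous R 'rV[R]_n 'rV[R]_m (mulmxr J)).
  apply/linear_boundedP; exists (n%:R * `|J|); split; first exact: num_real.
  move=> r rJ v; apply: le_trans (normr_mulmx_le v J) _.
  by rewrite ler_wpM2r// ltW.
have Jo (e : R) : 0 < e -> \forall v \near (0 : 'rV[R]_n),
    `|f (v + x0) - (f x0 + v *m J)| <= e * `|v|.
  move=> e0; have [delta d0 {}Jf] := Jf e e0.
  apply/nbhs_ballP; exists delta => //= v; rewrite -ball_normE/= sub0r normrN => vd.
  have := Jf x0 (v + x0); rewrite subrr normr0 addrK => /(_ d0 vd).
  by rewrite opprD addrA.
have dfE : 'd f x0 = mulmxr J :> (_ -> _).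
  by apply: (@diff_unique _ _ _ f (mulmxr J) x0 Jc); exact/eqaddoP.
apply/diff_locallyP; rewrite dfE; split => //; exact/eqaddoP.
Qed.

(** Sliding in a slice chart along the segment between the images of two points
    stays on [M], and the chart is nearly affine at small scales. *)
Lemma submanifold_nearly_convex N (M : set 'rV[R]_N) (y0 : 'rV[R]_N) (eta : R) :
  submanifold M -> M y0 -> 0 < eta ->
  exists2 delta, 0 < delta & forall y z, M y -> M z -> `|y - y0| < delta ->
    `|z - y0| < delta -> forall s, 0 <= s <= 1 ->
    exists2 q, M q & `|q - y - s *: (z - y)| <= eta * s * `|z - y|.
Proof.
move=> sM My0 eta0; have [k [U [V [phi [psi [_ Uy0]]]]]] := sM y0 My0.
case=> -[oU oV] [sphi spsi] phiK psiK Mphi.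
have [Vy0 psiy0] := phiK _ Uy0.
have [L L0 [d1 d10 Lphi]] := C1_lipschitz oU Uy0 (sphi 1%N).
have [J Jpsi] := C1_strictly_differentiable oV Vy0 (spsi 1%N).
have eta'0 : 0 < eta / (2 * L) by rewrite divr_gt0// mulr_gt0.
have [d2 d20 {}Jpsi] := Jpsi _ eta'0.
have : \forall z \near phi y0, V z by exact: open_nbhs_nbhs.
move=> /nbhs_ballP[d3 /= d30 d3V].
have : \forall y \near y0, U y by exact: open_nbhs_nbhs.
move=> /nbhs_ballP[d4 /= d40 d4U].
pose r := Num.min d2 d3; have r0 : 0 < r by rewrite lt_min d20.
have rL0 : 0 < r / L by rewrite divr_gt0.
exists (Num.min (Num.min d1 d4) (r / L)); first by rewrite !lt_min d10 d40.
have near_y0 y : M y -> `|y - y0| < Num.min (Num.min d1 d4) (r / L) ->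
    [/\ U y, `|y - y0| < d1, `|phi y - phi y0| < r
      & forall i : 'I_N, (k <= i)%N -> phi y 0 i = 0].
  move=> My; rewrite !lt_min => /andP[/andP[y1 y4] yr].
  have Uy : U y by apply: d4U; rewrite -ball_normE/= distrC.
  split=> //; last exact/(Mphi _ Uy).
  have y01 : `|y0 - y0| < d1 by rewrite subrr normr0.
  rewrite -lt_min.
  by apply: le_lt_trans (Lphi y0 y y01 y1) _; rewrite mulrC -ltr_pdivlMr.
move=> y z My Mz /near_y0 - /(_ My)[Uy yd1 yr Sy] /near_y0 - /(_ Mz)[Uz zd1 zr Sz].
move=> s /andP[s0 s1]; pose a := phi y; pose b := phi z.
pose m := a + s *: (b - a).
have mr : `|m - phi y0| < r.
  have -> : m - phi y0 = (1 - s) *: (a - phi y0) + s *: (b - phi y0).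
    by apply/rowP => i; rewrite !mxE; ring.
  rewrite (le_lt_trans (ler_normD _ _))// !normrZ !ger0_norm ?subr_ge0//.
  apply: le_lt_trans (_ : Num.max `|a - phi y0| `|b - phi y0| < _); last first.
    by rewrite gt_max yr.
  set A := Num.max _ _.
  have aM : `|a - phi y0| <= A by rewrite le_max lexx.
  have bM : `|b - phi y0| <= A by rewrite le_max lexx orbT.
  nra.
have [md2 Vm] : `|m - phi y0| < d2 /\ V m.
  move: mr; rewrite lt_min => /andP[? m3]; split=> //.
  by apply: d3V; rewrite -ball_normE/= distrC.
have [Um phim] := psiK _ Vm.
have d2P x : `|phi x - phi y0| < r -> `|phi x - phi y0| < d2.
  by rewrite lt_min => /andP[].
exists (psi m).
  by apply/(Mphi _ Um) => i ki; rewrite phim !mxE Sy// Sz// subrr mulr0 addr0.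
have [_ psiy] := phiK _ Uy; have [_ psiz] := phiK _ Uz.
have ma : m - a = s *: (b - a) by rewrite /m addrC addKr.
have -> : psi m - y - s *: (z - y) = (psi m - psi a - (m - a) *m J) -
    s *: (psi b - psi a - (b - a) *m J).
  rewrite /a /b psiy psiz ma -scalemxAl; apply/rowP => i; rewrite !mxE; ring.
have e1 := Jpsi _ _ (d2P _ yr) md2; have e2 := Jpsi _ _ (d2P _ yr) (d2P _ zr).
rewrite -/a -/b in e1 e2.
have e3 := Lphi _ _ yd1 zd1; rewrite -/a -/b in e3.
rewrite (le_trans (ler_normB _ _))//.
have e1n : `|m - a| = s * `|b - a| by rewrite ma normrZ ger0_norm.
rewrite e1n in e1; rewrite normrZ (ger0_norm s0).
apply: (@le_trans _ _ (eta / (2 * L) * (s * (L * `|z - y|)) +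
   s * (eta / (2 * L) * (L * `|z - y|)))).
  rewrite lerD//.
    by rewrite (le_trans e1)// ler_wpM2l ?(ltW eta'0)// ler_wpM2l.
  by rewrite ler_wpM2l// (le_trans e2)// ler_wpM2l ?(ltW eta'0).
rewrite le_eqVlt; apply/orP; left; apply/eqP; field; exact: lt0r_neq0.
Qed.

End submanifolds.

(** * Tangent spaces as ranges of orthogonal projectors *)

Section tangent_spaces.
Variable R : realType.

(** With [K] a basis of the kernel of [A] as rows, this is the usual formula
    [K^T (K K^T)^-1 K]; the Gram matrix [K K^T] is invertible because it is
    positive definite. *)
Lemma kernel_projector m n (A : 'M[R]_(m, n)) :
  exists P : 'M[R]_m, [/\ P^T = P, P *m P = P
    & forall v : 'rV[R]_m, v *m P = v <-> v *m A = 0].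
Proof.
pose K := row_base (kermx A).
have KA : K *m A = 0 by apply/sub_kermxP; rewrite eq_row_base.
have AK (v : 'rV[R]_m) : v *m A = 0 -> (v <= K)%MS.
  by move=> vA; rewrite eq_row_base; exact/sub_kermxP.
have /row_freeP[K' KK'] : row_free K := row_base_free (kermx A).
clearbody K; pose G := K *m K^T.
have Gu : G \in unitmx.
  rewrite -row_free_unit; apply/row_freeP.
  have : \rank (kermx G) = 0%N.
    apply/eqP; rewrite mxrank_eq0; apply/eqP/row_matrixP => i; rewrite row0.
    set u := row i _.
    have uG : u *m G = 0 by apply/sub_kermxP; rewrite row_sub.
    have : dot (u *m K) (u *m K) = 0.
      have uKK : u *m K *m K^T = 0 by rewrite -mulmxA.
      by rewrite /dot trmx_mul mulmxA uKK mul0mx mxE.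
    move/eqP; rewrite -enorm_sqr sqrf_eq0 enorm_eq0 => /eqP uK.
    by rewrite -(mulmx1 u) -KK' mulmxA uK mul0mx.
  rewrite mxrank_ker => /eqP; rewrite subn_eq0 => rG.
  by apply/row_freeP; rewrite /row_free eqn_leq rank_leq_row.
pose P := K^T *m invmx G *m K.
have GT : G^T = G by rewrite /G trmx_mul trmxK.
have KP : K *m P = K by rewrite /P !mulmxA -/G mulmxV// mul1mx.
exists P; split.
- by rewrite /P !trmx_mul trmxK trmx_inv GT mulmxA.
- by rewrite {1}/P -!mulmxA KP /P !mulmxA.
move=> v; split=> [<-|vA].
  by rewrite /P -!mulmxA KA !mulmx0.
by have /submxP[w ->] := AK _ vA; rewrite -mulmxA KP.
Qed.

Lemma derive_line n m (f : 'rV[R]_n -> 'rV[R]_m) (z w : 'rV[R]_n) (t u : R) :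
  (derivable f (z + t *: w) (u *: w) ->
    derivable (fun s : R => f (z + s *: w)) t u) /\
  'D_u (fun s : R => f (z + s *: w)) t = 'D_(u *: w) f (z + t *: w).
Proof.
rewrite /derivable /derive.
suff -> : (fun h : R => h^-1 *: (((fun s : R => f (z + s *: w)) \o shift t)
      (h *: u) - f (z + t *: w))) =
    (fun h => h^-1 *: ((f \o shift (z + t *: w)) (h *: (u *: w))
      - f (z + t *: w))) by [].
apply/funext => h /=; congr (_ *: (f _ - _)).
by rewrite scalerDl addrCA scalerA.
Qed.

(** Applied to the inverse of a slice chart, this makes the images of lines smooth
    curves on the submanifold. *)
Lemma class_C_line n m k (U : set 'rV[R]_n) (f : 'rV[R]_n -> 'rV[R]_m)
    (z w : 'rV[R]_n) (I : set R) :
  (forall t, I t -> U (z + t *: w)) ->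
  class_C k U f -> class_C k I (fun t : R => f (z + t *: w)).
Proof.
move=> IU; elim: k f => [|k IHk] f /= [fc fD]; split.
- move=> t It; apply: continuous_comp; last exact: fc (IU _ It).
  by apply: cvgD; [exact: cvg_cst|apply: cvgZr_tmp; exact: cvg_id].
- by [].
- move=> t It; apply: continuous_comp; last exact: fc (IU _ It).
  by apply: cvgD; [exact: cvg_cst|apply: cvgZr_tmp; exact: cvg_id].
move=> u; have [fd fC] := fD (u *: w); split.
  by move=> t It; apply: (derive_line f z w t u).1; exact: fd (IU _ It).
have -> : (fun t : R => 'D_u (fun s : R => f (z + s *: w)) t) =
    (fun t : R => 'D_(u *: w) f (z + t *: w)).
  by apply/funext => t; exact: (derive_line f z w t u).2.
exact: (IHk (fun x => 'D_(u *: w) f x)).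
Qed.

(** In a slice chart [phi], the tangent space is the kernel of the differential
    of the coordinates of [phi] that vanish on [M]. *)
Lemma tangent_space_projector N (M : set 'rV[R]_N) (x : 'rV[R]_N) :
  submanifold M -> M x -> exists P, orthogonal_projector P (tangent_space M x).
Proof.
move=> sM Mx; have [k [U [V [phi [psi [_ Ux]]]]]] := sM x Mx.
case=> -[oU oV] [sphi spsi] phiK psiK Mphi.
have [Vx psix] := phiK _ Ux.
have dphi := C1_differentiable oU Ux (sphi 1%N).
have dpsi := C1_differentiable oV Vx (spsi 1%N).
have dpsiK v : 'd psi (phi x) ('d phi x v) = v.
  have -> : 'd psi (phi x) ('d phi x v) = 'd (psi \o phi) x v.
    exact: esym (congr1 (fun g => g v) (diff_comp dphi dpsi)).
  rewrite -deriveE; last exact: differentiable_comp.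
  rewrite -[RHS](@derive_id R 'rV[R]_N x v); apply: near_eq_derive.
  have : \forall y \near x, U y by exact: open_nbhs_nbhs.
  by apply: filterS => y /phiK[].
pose mask : 'M[R]_N := diag_mx (\row_i (k <= i)%:R).
have maskP (v : 'rV[R]_N) : v *m (jacobian phi x *m mask) = 0 <->
    forall i : 'I_N, (k <= i)%N -> 'd phi x v 0 i = 0.
  rewrite mulmxA -deriveEjacobian// deriveE//; split=> [/rowP v0 i ki|v0].
    by have := v0 i; rewrite mul_mx_diag !mxE ki mulr1.
  apply/rowP => i; rewrite mul_mx_diag !mxE.
  by have [/v0->|_] := boolP (k <= i)%N; rewrite ?mul0r ?mulr0.
have [P [PT PP PE]] := kernel_projector (jacobian phi x *m mask).
exists P; split=> //; apply/seteqP; split=> v.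
- case=> c [e [e0 sc cM c0 c1]]; apply/PE/maskP => i ki.
  have I0 : - e < 0 < e by rewrite oppr_lt0 e0.
  have [cc cD] := sc 1%N.
  have cd : differentiable c 0 by apply/derivable1_diffP; exact: (cD 1).1.
  have dphi' : differentiable phi (c 0) by rewrite c0.
  have d0 : 'd phi x v = 'd phi (c 0) ('d c 0 1).
    rewrite -(@deriveE _ _ _ c 0 1 cd).
    exact: etrans (congr1 (fun y => 'd phi y v) (esym c0))
      (congr1 ('d phi (c 0)) (esym c1)).
  have -> : 'd phi x v = 'D_1 (phi \o c) 0.
    rewrite d0 deriveE; last exact: differentiable_comp.
    exact: esym (congr1 (fun g => g 1) (diff_comp cd dphi')).
  rewrite derive_mx; last first.
    by apply: diff_derivable; exact: differentiable_comp.
  rewrite mxE; rewrite -[RHS](@derive_cst _ _ _ (0 : R) (0 : R) 1).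
  apply: near_eq_derive.
  have cU : \forall t \near (0 : R), U (c t).
    have : \forall y \near c 0, U y by rewrite c0; exact: open_nbhs_nbhs.
    exact: (cc 0 I0).
  have tI : \forall t \near (0 : R), - e < t < e.
    apply/nbhs_ballP; exists e => //= t; rewrite -ball_normE/= sub0r normrN.
    by rewrite ltr_norml.
  near=> t; rewrite /= /cst.
  have Ut : U (c t) by near: t.
  have Mt : M (c t) by apply: cM; near: t.
  exact: (Mphi _ Ut).1 Mt i ki.
move=> /PE/maskP v0; pose w := 'd phi x v.
have : \forall y \near phi x, V y by exact: open_nbhs_nbhs.
move=> /nbhs_ballP[d /= d0 dV].
have e0 : 0 < d / (`|w| + 1) by rewrite divr_gt0// ltr_wpDl.
(* below this time the line of speed w stays in the ball of radius d *)
have IV t : - (d / (`|w| + 1)) < t < d / (`|w| + 1) -> V (phi x + t *: w).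
  rewrite -ltr_norml => td; apply: dV; rewrite -ball_normE/= distrC addrC addKr.
  rewrite normrZ; move: td; rewrite ltr_pdivlMr ?ltr_wpDl// => td.
  by rewrite (le_lt_trans _ td)// ler_wpM2l// lerDl.
exists (fun t : R => psi (phi x + t *: w)), (d / (`|w| + 1)); split => //.
- move=> n; exact: (class_C_line IV (spsi n)).
- move=> t /IV/psiK[Ut phit]; apply/(Mphi _ Ut) => i ki.
  by rewrite phit !mxE v0// mulr0 addr0; exact: (Mphi _ Ux).1 Mx i ki.
- by rewrite scale0r addr0.
rewrite (derive_line psi (phi x) w 0 1).2 scale0r addr0 scale1r.
exact: etrans (deriveE w dpsi) (dpsiK v).
Unshelve. all: by end_near. Qed.

End tangent_spaces.

(** * Limits of matrices *)

Section matrix_limits.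
Variable R : realType.

Lemma cvg_mx (T : Type) (F : set_system T) {FF : Filter F} m n
    (f : T -> 'M[R]_(m, n)) (A : 'M[R]_(m, n)) :
  (forall i j, f t i j @[t --> F] --> A i j) -> f @ F --> A.
Proof.
move=> fA; apply/cvgrPdist_le => e e0.
have : \forall t \near F, forall ij : 'I_m * 'I_n,
    `|A ij.1 ij.2 - f t ij.1 ij.2| <= e.
  apply: filter_forall => ij.
  have /cvgrPdist_le := fA ij.1 ij.2; exact.
apply: filterS => t ft; apply: normr_mx_le (ltW e0) _ => i j.
by rewrite !mxE; exact: ft (i, j).
Qed.

Lemma cvg_mxE (T : Type) (F : set_system T) {FF : Filter F} m n
    (f : T -> 'M[R]_(m, n)) (A : 'M[R]_(m, n)) :
  f @ F --> A -> forall i j, f t i j @[t --> F] --> A i j.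
Proof.
move=> fA i j; apply/cvgrPdist_le => e e0; have /cvgrPdist_le/(_ _ e0) := fA.
by apply: filterS => t; apply: le_trans; have := normr_coord_le (A - f t) i j;
  rewrite !mxE.
Qed.

Lemma cvg_trmx (T : Type) (F : set_system T) {FF : Filter F} m n
    (f : T -> 'M[R]_(m, n)) (A : 'M[R]_(m, n)) :
  f @ F --> A -> (f t)^T @[t --> F] --> A^T.
Proof.
move=> fA; apply: cvg_mx => i j; rewrite mxE.
by under eq_fun do rewrite mxE; exact: cvg_mxE.
Qed.

Lemma cvg_mulmx (T : Type) (F : set_system T) {FF : Filter F} m n p
    (f : T -> 'M[R]_(m, n)) (g : T -> 'M[R]_(n, p)) (A : 'M[R]_(m, n))
    (B : 'M[R]_(n, p)) :
  f @ F --> A -> g @ F --> B -> f t *m g t @[t --> F] --> A *m B.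
Proof.
move=> fA gB; apply: cvg_mx => i j; rewrite mxE.
under eq_fun do rewrite mxE.
apply: (@cvg_big _ _ +%R 0 xpredT (@add_continuous R) _ F _
  (fun k t => f t i k * g t k j) (fun k => A i k * B k j)) => k _.
by apply: cvgM; exact: cvg_mxE.
Qed.

Lemma eq_cvg_seq (V : normedModType R) (f g : nat -> V) (a b : V) :
  f =1 g -> f @ \oo --> a -> g @ \oo --> b -> a = b.
Proof.
move=> /funext -> ga gb.
by apply: (@cvg_unique V (@norm_hausdorff _ V) (g @ \oo)).
Qed.

Lemma cvg_subseq (T : topologicalType) (z : nat -> T) (l : T) (g : nat -> nat) :
  (forall n, (n <= g n)%N) -> z n @[n --> \oo] --> l ->
  z (g n) @[n --> \oo] --> l.
Proof.
move=> gn zl; apply: cvg_comp zl; apply/cvgnyPge => k.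
by exists k => // n /= kn; exact: leq_trans kn (gn n).
Qed.

(** The condition on [g] makes its values tend to infinity, so that limits of other
    sequences persist along [g]. *)
Lemma bounded_rV_subseq m (z : nat -> 'rV[R]_m) (B : R) :
  (forall n, `|z n| <= B) ->
  exists (g : nat -> nat) (l : 'rV[R]_m),
    (forall n, (n <= g n)%N) /\ z (g n) @[n --> \oo] --> l.
Proof.
move=> zB; pose K := [set v : 'rV[R]_m | `|v| <= B].
have cK : compact K.
  apply: bounded_closed_compact.
    exists B; split; first exact: num_real.
    by move=> c Bc v /= vB; exact: le_trans vB (ltW Bc).
  apply: (@preimage_closed _ _ (fun v : 'rV[R]_m => `|v|) [set x | x <= B]).
    by move=> v _; exact: norm_continuous.
  exact: closed_le.
have FK : (z @ \oo) K by exists 0%N => // n _; exact: zB.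
have [l [_ lc]] := cK (z @ \oo) _ FK.
have gP n : {k | (n <= k)%N /\ `|l - z k| < n.+1%:R^-1}.
  apply: cid; have [||v [[k nk <-] lk]] := lc [set z k | k in [set k | n <= k]%N]
    (ball l n.+1%:R^-1).
  - by exists n => // k /= nk; exists k.
  - by apply: nbhsx_ballx; rewrite invr_gt0.
  - by exists k; split=> //; move: lk; rewrite -ball_normE.
exists (fun n => sval (gP n)), l; split.
  by move=> n; case: (gP n) => k [].
apply/cvgrPdist_lt => e e0; have := near_infty_natSinv_lt (PosNum e0).
by apply: filterS => n /=; apply: lt_trans; case: (gP n) => k [].
Qed.

Lemma bounded_mx_subseq m n (z : nat -> 'M[R]_(m, n)) (B : R) :
  (forall n, `|z n| <= B) ->
  exists (g : nat -> nat) (l : 'M[R]_(m, n)),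
    (forall n, (n <= g n)%N) /\ z (g n) @[n --> \oo] --> l.
Proof.
move=> zB; have [|g [l [gn zl]]] := @bounded_rV_subseq _ (fun n => mxvec (z n)) B.
  move=> k; apply: normr_mx_le => [|i j]; first exact: le_trans (zB k).
  rewrite ord1; case/mxvec_indexP: j => i' j'.
  by rewrite mxvecE (le_trans (normr_coord_le _ _ _)).
exists g, (vec_mx l); split=> //; apply: cvg_mx => i j.
rewrite mxE.
have -> : (fun k => z (g k) i j) = fun k => mxvec (z (g k)) 0 (mxvec_index i j).
  by apply/funext => k; rewrite mxvecE.
apply: (@cvg_mxE _ \oo _ 1 _ (fun k => mxvec (z (g k))) l zl 0 (mxvec_index i j)).
Qed.

End matrix_limits.

(** * Condition (b) and the angle between secants and tangent spaces *)

Section whitney_condition.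
Variables (R : realType) (N : nat).
Implicit Types (x y u : 'rV[R]_N).

Lemma line_scale (a : R) u : a != 0 -> line (a *: u) = line u.
Proof.
move=> a0; apply/seteqP; split=> _ [c _ <-].
  by exists (c * a) => //; rewrite scalerA.
by exists (c / a) => //; rewrite scalerA divfK.
Qed.

Lemma line_projector u : dot u u = 1 -> orthogonal_projector (u^T *m u) (line u).
Proof.
move=> uu; have uuT : u *m u^T = 1%:M.
  by rewrite [u *m u^T]mx11_scalar -/(dot u u) uu.
split; first by rewrite trmx_mul trmxK.
  by rewrite mulmxA -(mulmxA u^T) uuT mulmx1.
apply/seteqP; split=> v.
  by case=> c _ <- /=; rewrite -scalemxAl mulmxA uuT mul1mx.
move=> /= vE; exists (dot v u) => //; rewrite -[RHS]vE mulmxA.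
by rewrite (mx11_scalar (v *m u^T)) mul_scalar_mx.
Qed.

(** The squares of the entries in row [i] of an orthogonal projector add up to its
    diagonal entry [P i i], which is therefore at most 1. *)
Lemma projector_norm_le1 (P : 'M[R]_N) : P^T = P -> P *m P = P -> `|P| <= 1.
Proof.
move=> PT PP; apply: normr_mx_le => // i j.
have sqP : P i i = \sum_k P i k ^+ 2.
  rewrite -{1}PP mxE; apply: eq_bigr => k _; rewrite expr2; congr (_ * _).
  by rewrite -{1}PT mxE.
have rowP k : P i k ^+ 2 <= P i i.
  by rewrite sqP (bigD1 k)//= lerDl sumr_ge0// => ? _; exact: sqr_ge0.
have Pii : P i i <= 1.
  have [//|Pii] := leP (P i i) 1; have := rowP i; nra.
by rewrite -(@expr_le1 _ 2)// real_normK ?num_real// (le_trans (rowP j)).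
Qed.

(** If the tangent spaces made a definite angle with the secants at points
    arbitrarily close to the compact set [Mp], a subsequence of the pairs of
    points would converge along with its secant lines and tangent spaces, and the
    limit would contradict condition (b). *)
Lemma whitney_b_tangent_secant (Mq Mp : set 'rV[R]_N) (kappa : R) :
  submanifold Mq -> compact Mp -> whitney_b Mq Mp -> kappa < 1 ->
  exists2 rho, 0 < rho & forall x y, Mq x -> Mp y -> enorm (x - y) < rho ->
    exists h, [/\ tangent_space Mq x h, enorm h <= 1
      & kappa * enorm (x - y) <= dot h (x - y)].
Proof.
move=> sMq cMp whb k1; apply: contrapT => /forall2NP nrho.
have /choice[xy xyP] (n : nat) : exists xy : 'rV[R]_N * 'rV[R]_N,
    [/\ Mq xy.1, Mp xy.2, enorm (xy.1 - xy.2) < n.+1%:R^-1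
      & ~ exists h, [/\ tangent_space Mq xy.1 h, enorm h <= 1
      & kappa * enorm (xy.1 - xy.2) <= dot h (xy.1 - xy.2)]].
  have [|] := nrho n.+1%:R^-1; first by rewrite invr_gt0.
  move=> /existsNP[x /existsNP[y /not_implyP[Mx /not_implyP[My]]]].
  by move=> /not_implyP[xyn nh]; exists (x, y).
pose x n := (xy n).1; pose y n := (xy n).2.
have xq n : Mq (x n) by case: (xyP n).
have yp n : Mp (y n) by case: (xyP n).
have xyn n : enorm (x n - y n) < n.+1%:R^-1 by case: (xyP n).
have /choice[P PT] n := tangent_space_projector sMq (xq n).
pose u n := (enorm (x n - y n))^-1 *: (x n - y n).
have xy0 n : enorm (x n - y n) != 0.
  apply/eqP => e0; case: (xyP n) => _ _ _; apply; exists 0.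
  have [_ _ ->] := PT n; rewrite /= mul0mx enorm0 ler01; split => //.
  by rewrite -/(x n) -/(y n) e0 mulr0 dot0l.
have xyE n : x n - y n = enorm (x n - y n) *: u n.
  by rewrite scalerA divff// scale1r.
have u1 n : dot (u n) (u n) = 1.
  rewrite /u dotZl dotZr -enorm_sqr expr2; field; exact: xy0.
have en1 n : enorm (u n) = 1 by rewrite enormE u1 sqrtr1.
(* the projection of u n to the tangent space is a candidate for h *)
have uPk n : dot (u n *m P n) (u n) < kappa.
  rewrite ltNge; apply/negP => kP; case: (xyP n) => _ _ _; apply.
  exists (u n *m P n); have [PT1 PP ->] := PT n.
  have uPP : dot (u n *m P n) (u n *m P n) = dot (u n *m P n) (u n).
    by rewrite /dot trmx_mul PT1 !mulmxA -(mulmxA (u n)) PP.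
  split; first by rewrite /= -mulmxA PP.
    have := cauchy_schwarz (u n *m P n) (u n).
    rewrite -uPP -enorm_sqr en1 mulr1 expr2; have := enorm_ge0 (u n *m P n); nra.
  by rewrite -/(x n) -/(y n) {2}xyE dotZr mulrC ler_wpM2l ?enorm_ge0.
have /compact_bounded[B0 [_ yB0]] := cMp.
have yB n : `|y n| <= B0 + 1 by apply: yB0; rewrite ?ltrDl.
have [g1 [y0 [g1n y0P]]] := bounded_mx_subseq yB.
have uB n : `|u (g1 n)| <= 1 by rewrite (le_trans (normr_le_enorm _))// en1.
have [g2 [u0 [g2n u0P]]] := bounded_mx_subseq uB.
have PB n : `|P (g1 (g2 n))| <= 1.
  by have [? ? _] := PT (g1 (g2 n)); exact: projector_norm_le1.
have [g3 [P0 [g3n P0P]]] := bounded_mx_subseq PB.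
pose k n := g1 (g2 (g3 n)).
have kn n : (n <= k n)%N by rewrite (leq_trans (g3n n))// (leq_trans (g2n _)).
have yk : y (k n) @[n --> \oo] --> y0.
  apply: (@cvg_subseq _ (fun n => y (g1 n)) y0 (g2 \o g3)) y0P => n.
  exact: leq_trans (g3n n) (g2n _).
have uk : u (k n) @[n --> \oo] --> u0 by exact: (cvg_subseq g3n u0P).
have xk : x (k n) @[n --> \oo] --> y0.
  have -> : (fun n => x (k n)) = (fun n => y (k n) + (x (k n) - y (k n))).
    by apply/funext => n; rewrite addrC subrK.
  rewrite -[y0]addr0; apply: cvgD => //; apply/cvgrPdist_lt => e e0.
  have := near_infty_natSinv_lt (PosNum e0); apply: filterS => n /=.
  rewrite sub0r normrN; apply: lt_trans.
  rewrite (le_lt_trans (normr_le_enorm _))// (lt_le_trans (xyn _))//.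
  by rewrite lef_pV2 ?posrE// ler_nat ltnS.
have My0 : Mp y0.
  have cl : closed Mp by apply: compact_closed cMp; exact: norm_hausdorff.
  apply: (@closed_cvg _ _ \oo _ (fun n => y (k n)) Mp cl _ y0 yk).
  by exists 0%N.
have u01 : dot u0 u0 = 1.
  have uu : (u (k n) *m (u (k n))^T) 0 0 @[n --> \oo] --> (u0 *m u0^T) 0 0.
    by apply: cvg_mxE; apply: cvg_mulmx => //; exact: cvg_trmx.
  have c1 : (fun=> 1) @ \oo --> (1 : R) by exact: cvg_cst.
  pose fuu n : R := (u (k n) *m (u (k n))^T) 0 0.
  exact: (@eq_cvg_seq R R fuu (fun=> 1) (dot u0 u0) 1 (fun n => u1 (k n)) uu c1).
have lcvg : subspace_cvg (fun n => line (x (k n) - y (k n))) (line u0).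
  exists (fun n => (u (k n))^T *m u (k n)), (u0^T *m u0); split.
  - move=> n; rewrite xyE line_scale ?xy0//; exact: line_projector.
  - exact: line_projector.
  - by apply: cvg_mulmx => //; exact: cvg_trmx.
have P0T : P0^T = P0.
  by apply: eq_cvg_seq (cvg_trmx P0P) P0P => n; have [-> _ _] := PT (k n).
have P0P0 : P0 *m P0 = P0.
  by apply: eq_cvg_seq (cvg_mulmx P0P P0P) P0P => n; have [_ -> _] := PT (k n).
have tcvg : subspace_cvg (fun n => tangent_space Mq (x (k n)))
    [set v | v *m P0 = v].
  by exists (fun n => P (k n)), P0.
have /(_ u0)/= u0P0 := whb (x \o k) (y \o k) y0 _ _ (fun n => xq _) (fun n => yp _)
  My0 xk yk lcvg tcvg.
have {}u0P0 : u0 *m P0 = u0 by apply: u0P0; exists 1; rewrite ?scale1r.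
have : dot (u (k n) *m P (k n)) (u (k n)) @[n --> \oo] --> dot (u0 *m P0) u0.
  by apply: cvg_mxE; apply: cvg_mulmx; [exact: cvg_mulmx|exact: cvg_trmx].
rewrite u0P0 u01 => /cvgr_gt/(_ _ k1).
by case/filter_ex => n; apply/negP; rewrite -leNgt ltW//; exact: uPk.
Qed.

End whitney_condition.

(** * Distance to a compact submanifold *)

Section distance.
Variables (R : realType) (N : nat).
Implicit Types (A M : set 'rV[R]_N) (x y z p q : 'rV[R]_N).

Definition nearest A x p := A p /\ forall q, A q -> enorm (x - p) <= enorm (x - q).

Definition rdist A x : R := fine (dist_set x A).

Lemma nearest_dist A x p : nearest A x p -> dist_set x A = (enorm (x - p))%:E.
Proof.
move=> [Ap xp]; apply/eqP; rewrite eq_le; apply/andP; split.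
  by apply: ereal_inf_lbound; exists p.
by apply: le_ereal_inf_tmp => _ [q Aq <-]; rewrite lee_fin xp.
Qed.

Lemma nearest_rdist A x p : nearest A x p -> rdist A x = enorm (x - p).
Proof. by move=> /nearest_dist; rewrite /rdist => ->. Qed.

Lemma nearest_exists A x : compact A -> A !=set0 -> exists p, nearest A x p.
Proof.
move=> cA A0; have [|p] := @EVT_min_rV R N (fun y => enorm (y - x)) A A0 cA.
  by apply: continuous_subspaceT => y; exact: enorm_continuous.
rewrite inE => Ap xp; exists p; split=> // q Aq.
by rewrite !(enormBC x) xp// inE.
Qed.

Section compact_set.
Variable A : set 'rV[R]_N.
Hypotheses (cA : compact A) (A0 : A !=set0).

Lemma dist_setE x : dist_set x A = (rdist A x)%:E.
Proof.
by have [p px] := nearest_exists x cA A0; rewrite (nearest_dist px) (nearest_rdist px).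
Qed.

Lemma rdist_ge0 x : 0 <= rdist A x.
Proof.
by have [p px] := nearest_exists x cA A0; rewrite (nearest_rdist px) enorm_ge0.
Qed.

Lemma rdist_le x q : A q -> rdist A x <= enorm (x - q).
Proof.
by have [p px] := nearest_exists x cA A0; rewrite (nearest_rdist px) => /px.2.
Qed.

Lemma rdist_mem x : A x -> rdist A x = 0.
Proof.
move=> Ax; apply/eqP; rewrite eq_le rdist_ge0 andbT -(enorm0 R N) -(subrr x).
exact: rdist_le.
Qed.

Lemma rdist_leD x y : rdist A x <= rdist A y + enorm (x - y).
Proof.
have [p py] := nearest_exists y cA A0; rewrite (nearest_rdist py) addrC.
by apply: le_trans (rdist_le x py.1) _; exact: ler_enorm_distD.
Qed.

Lemma rdist_continuous : continuous (rdist A).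
Proof.
move=> x; apply/(@cvgrPdist_lt _ _ _ (nbhs x) (nbhs_filter x)) => e e0.
have := @enorm_cvg R N _ (nbhs x) (nbhs_filter x) id x (@cvg_id _ _) e e0.
apply: filterS => z; apply: le_lt_trans; rewrite ler_norml.
have := rdist_leD x z; have := rdist_leD z x.
by rewrite (enormBC x z) => *; apply/andP; split; lra.
Qed.

End compact_set.

(** A scale at which [submanifold_nearly_convex] holds can be chosen uniformly on a
    compact submanifold. *)
Lemma compact_submanifold_nearly_convex M (eta : R) :
  submanifold M -> compact M -> 0 < eta ->
  exists2 rho, 0 < rho & forall p q, M p -> M q -> enorm (q - p) < rho ->
    forall s, 0 <= s <= 1 ->
    exists2 m, M m & enorm (m - p - s *: (q - p)) <= eta * s * enorm (q - p).
Proof.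
move=> sM cM eta0.
pose Q (rho : R) p := forall q, M q -> enorm (q - p) < rho ->
  forall s, 0 <= s <= 1 ->
  exists2 m, M m & enorm (m - p - s *: (q - p)) <= eta * s * enorm (q - p).
have eta'0 : 0 < eta / N.+1%:R by rewrite divr_gt0.
have /compact_near_coveringP/near_covering_withinP := cM.
move=> /(_ R (0 : R)^'+ Q _)[|rho [rho0 MQ]].
- move=> p0 Mp0; have [d d0 dP] := submanifold_nearly_convex sM Mp0 eta'0.
  have d20 : 0 < d / 2 by rewrite divr_gt0.
  exists (ball p0 (d / 2), [set r : R | r < d / 2]) => /=.
    by split; [exact: nbhsx_ballx|exact: nbhs_right_lt].
  move=> -[p r] /= [pp0 rd] Mp q Mq qp s s01.
  rewrite -ball_normE/= distrC in pp0.
  have qp0 : `|q - p0| < d.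
    rewrite -(subrKA p) (le_lt_trans (ler_normD _ _))// [d]splitr ltrD//.
    by rewrite (le_lt_trans (normr_le_enorm _))// (lt_trans qp).
  have pp0' : `|p - p0| < d by rewrite (lt_trans pp0)// ltr_pdivrMr// ltr_pMr// ltr1n.
  have [m Mm mE] := dP p q Mp Mq pp0' qp0 s s01; exists m => //.
  rewrite (le_trans (enorm_le_normr _))// mulrC -ler_pdivlMr//.
  rewrite (le_trans mE)//.
  have s0 : 0 <= s by case/andP: s01.
  rewrite [leRHS](_ : _ = eta / N.+1%:R * s * enorm (q - p)); last by ring.
  by rewrite ler_wpM2l ?normr_le_enorm// mulr_ge0// ltW.
have r20 : 0 < rho / 2 by rewrite divr_gt0.
exists (rho / 2) => // p q Mp Mq qp.
apply: (MQ (rho / 2)) => //=; rewrite sub0r normrN gtr0_norm//.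
by rewrite ltr_pdivrMr// ltr_pMr// ltr1n.
Qed.

(** Moving from the nearest point [p] slightly towards [q] along [M] does not get
    closer to [x], so that [x - p] makes an almost right angle with [q - p]. *)
Lemma nearest_almost_normal M (eta : R) :
  submanifold M -> compact M -> 0 < eta ->
  exists2 rho, 0 < rho & forall x p q, nearest M x p -> M q ->
    enorm (q - p) < rho -> dot (x - p) (q - p) <= eta * enorm (x - p) * enorm (q - p).
Proof.
move=> sM cM eta0; have [rho rho0 rhoP] := compact_submanifold_nearly_convex sM cM eta0.
exists rho => // x p q [Mp xp] Mq qp; rewrite -subr_le0.
set T := _ - _; pose c := (1 + eta) ^+ 2 * enorm (q - p) ^+ 2.
(* |x - p| <= |x - m| for the point m of M near p + s (q - p); the error term
   in s is divided out and the quadratic one disappears as s tends to 0 *)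
have Tc s : 0 < s <= 1 -> 2 * T <= c * s.
  move=> /andP[s0 s1]; have s01 : 0 <= s <= 1 by rewrite (ltW s0).
  have [m Mm] := rhoP p q Mp Mq qp s s01; set e := m - p - _ => eE.
  have mp : m - p = s *: (q - p) + e by rewrite /e [RHS]addrC subrK.
  clearbody e.
  have xm : enorm (x - p) ^+ 2 <= enorm ((x - p) - (m - p)) ^+ 2.
    by rewrite lerXn2r ?nnegrE ?enorm_ge0// opprB addrA subrK xp.
  rewrite (enorm_sqrB (x - p) (m - p)) in xm.
  have mpn : enorm (m - p) <= (1 + eta) * s * enorm (q - p).
    rewrite mp (le_trans (ler_enormD _ _))// enormZ gtr0_norm//.
    by rewrite -mulrA mulrDl mul1r lerD// mulrA.
  have mp2 : enorm (m - p) ^+ 2 <= c * s ^+ 2.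
    have -> : c * s ^+ 2 = ((1 + eta) * s * enorm (q - p)) ^+ 2 by rewrite /c; ring.
    by rewrite lerXn2r ?nnegrE ?enorm_ge0// (le_trans _ mpn)// enorm_ge0.
  have dE : dot (x - p) (m - p) = s * dot (x - p) (q - p) + dot (x - p) e.
    by rewrite mp [LHS]dotDr dotZr.
  have de : - (enorm (x - p) * (eta * s * enorm (q - p))) <= dot (x - p) e.
    rewrite lerNl; apply: le_trans (ler_norm _) _; rewrite normrN.
    by rewrite (le_trans (normr_dot _ _))// ler_wpM2l ?enorm_ge0.
  rewrite -(ler_pM2l s0) /T; move: xm mp2 de; rewrite dE.
  set d := dot (x - p) (q - p); set d' := dot _ e; set a := enorm (x - p).
  set b := enorm (q - p); set f := enorm _ ^+ 2; rewrite expr2.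
  lra.
rewrite leNgt; apply/negP => T0.
have c0 : 0 <= c by rewrite mulr_ge0// sqr_ge0.
have c1 : 0 < c + 1 by rewrite ltr_wpDl.
have s0 : 0 < Num.min 1 (T / (c + 1)) by rewrite lt_min ltr01 divr_gt0.
have := Tc (Num.min 1 (T / (c + 1))); rewrite s0 ge_min lexx => /(_ isT).
apply/negP; rewrite -ltNge.
apply: (@le_lt_trans _ _ (c * (T / (c + 1)))).
  by rewrite ler_wpM2l// ge_min lexx orbT.
rewrite mulrA ltr_pdivrMr//; nra.
Qed.

(** The norm of [x - p] is at least the component of [x - p] along [y - p]: its
    difference with the norm of [y - p] thus has a lower bound linear in [x - y]. *)
Lemma enorm_sub_ge x y p :
  dot (x - y) (y - p) <= enorm (y - p) * (enorm (x - p) - enorm (y - p)).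
Proof.
have := cauchy_schwarz (x - p) (y - p).
have -> : dot (x - p) (y - p) = dot (x - y) (y - p) + enorm (y - p) ^+ 2.
  by rewrite enorm_sqr -dotDl subrKA.
by rewrite expr2; lra.
Qed.

Lemma tangent_space_approx M x h (theta : R) :
  tangent_space M x h -> 0 < theta ->
  exists2 t0, 0 < t0 & forall t, 0 < `|t| < t0 ->
    exists2 z, M z & enorm (z - x - t *: h) <= theta * `|t|.
Proof.
case=> c [e [e0 /(_ 1%N)[_ cD] cM c0 c1]] theta0.
have I0 : - e < 0 < e by rewrite oppr_lt0 e0.
have cd : derivable c 0 1 by exact: (cD 1).1.
have {}cd : (fun t : R => t^-1 *: ((c \o shift 0) (t *: 1) - c 0)) @ 0^' --> h.
  by rewrite -c1; exact: cd.
have [d /= d0 dP] : \forall t \near 0^',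
    enorm (t^-1 *: ((c \o shift 0) (t *: 1) - c 0) - h) < theta.
  exact: enorm_cvg.
exists (Num.min d e) => [|t]; first by rewrite lt_min d0.
rewrite lt_min => /andP[t0 /andP[td te]]; exists (c t).
  by apply: cM; rewrite -ltr_norml.
have := dP t; rewrite /= sub0r normrN => /(_ td).
rewrite normr_gt0 in t0; move=> /(_ t0) /=; rewrite addr0 [t%:A]mulr1 c0 => h1.
have -> : c t - x - t *: h = t *: (t^-1 *: (c t - x) - h).
  by rewrite scalerBr scalerA divff// scale1r.
by rewrite enormZ mulrC ler_wpM2r// ltW.
Qed.

End distance.

(** * Slopes of the distance along the open stratum *)

Section slopes.
Variables (R : realType) (N : nat).
Implicit Types (M Mp Mq : set 'rV[R]_N) (x y z p q : 'rV[R]_N).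

(** By the near-orthogonality of [x - p] to [M] the points of [M] that are almost as
    close to [x] as [p] lie in a ball around [p] of radius small compared to the
    distance. *)
Lemma almost_nearest_close M (eta : R) :
  submanifold M -> compact M -> 0 < eta <= 1 ->
  exists2 rho, 0 < rho & forall x p q, nearest M x p -> M q ->
    enorm (x - p) < rho ->
    enorm (x - q) ^+ 2 <= (1 + eta ^+ 2) * enorm (x - p) ^+ 2 ->
    enorm (q - p) <= 3 * eta * enorm (x - p).
Proof.
move=> sM cM /andP[eta0 eta1].
have [rho rho0 rhoP] := nearest_almost_normal sM cM eta0.
exists (rho / 3) => [|x p q np Mq xp xq]; first by rewrite divr_gt0.
have r0 := enorm_ge0 (x - p); have q0 := enorm_ge0 (x - q).
have w0 := enorm_ge0 (q - p).
have qp : enorm (q - p) < rho.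
  have := ler_enorm_distD x q p; rewrite (enormBC q x) => qxp.
  have : enorm (x - q) <= 2 * enorm (x - p).
    rewrite -ler_sqr ?nnegrE// ?mulr_ge0// exprMn (le_trans xq)//.
    by rewrite ler_wpM2r ?sqr_ge0//; nra.
  by move: xp; rewrite ltr_pdivlMr//; lra.
have := rhoP x p q np Mq qp; move: xq.
have -> : x - q = (x - p) - (q - p) by rewrite opprB addrA subrK.
rewrite enorm_sqrB => xq dxq; rewrite leNgt; apply/negP => lt.
have h1 : 0 < enorm (q - p) by apply: le_lt_trans lt; rewrite !mulr_ge0// ltW.
move: xq dxq lt h1 r0; set w := enorm (q - p); set r := enorm (x - p).
set d := dot _ _ => xq dxq lt h1 r0.
have : w ^+ 2 <= 2 * (eta * r * w) + eta ^+ 2 * r ^+ 2 by nra.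
have er : 0 <= eta * r by rewrite mulr_ge0// ltW.
by rewrite -exprMn; nra.
Qed.

(** The tangent vector [h] provided by condition (b) for the nearest point of [x]
    makes a small angle with the direction away from every almost nearest point,
    so that the distance changes at almost unit speed in the directions [h] and
    [- h]. *)
Lemma whitney_slopes Mp Mq (C : R) :
  submanifold Mp -> submanifold Mq -> compact Mp -> Mp !=set0 ->
  whitney_b Mq Mp -> 1 < C ->
  exists2 rho, 0 < rho & forall x (e : R), Mq x -> 0 < rdist Mp x < rho -> 0 < e ->
    (exists z, [/\ Mq z, rdist Mp x < rdist Mp z < rdist Mp x + e
       & enorm (z - x) <= C * (rdist Mp z - rdist Mp x)]) /\
    (exists z, [/\ Mq z, rdist Mp x - e < rdist Mp z < rdist Mp x
       & enorm (z - x) <= C * (rdist Mp x - rdist Mp z)]).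
Proof.
move=> sMp sMq cMp Mp0 whb C1; pose theta := (1 - C^-1) / 10.
have C0 : 0 < C by exact: lt_trans C1.
have CV1 : C^-1 < 1 by rewrite invf_lt1.
have CV0 : 0 < C^-1 by rewrite invr_gt0.
(* the angles and approximations below lose a speed of at most 8 theta; theta is
   chosen such that C compensates for this loss (Ctheta) *)
have t0 : 0 < theta by rewrite divr_gt0// subr_gt0.
have t1 : theta <= 10^-1 by rewrite /theta ler_piMl//; lra.
have Ctheta : C^-1 * (1 + theta) <= 1 - 8 * theta.
  have : 10 * theta = 1 - C^-1 by rewrite /theta mulrC divfK.
  nra.
have theta01 : 0 < theta <= 1 by rewrite t0; lra.
have kappa1 : 1 - theta < 1 by lra.
have [rho1 rho10 normP] := almost_nearest_close sMp cMp theta01.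
have [rho2 rho20 tanP] := whitney_b_tangent_secant sMq cMp whb kappa1.
exists (Num.min rho1 rho2); first by rewrite lt_min rho10.
move=> x e Mx /andP[dx0]; rewrite lt_min => /andP[dx1 dx2] e0.
have [p0 np0] := nearest_exists x cMp Mp0; have [Mp0' _] := np0.
have dE := nearest_rdist np0; set r := rdist Mp x in dx0 dx1 dx2 dE *.
have [|h [hT h1 hx]] := tanP x p0 Mx Mp0'; first by rewrite -dE.
have [tau tau0 tauP] := tangent_space_approx hT t0.
(* the bounds keep z where the expansion of tauP holds, within e of x, and so
   close to x compared with r that the points nearest to z are almost nearest to x *)
pose t := Num.min (tau / 2) (Num.min (e / 4) (theta ^+ 2 * r / 16)).
have tp : 0 < t by rewrite !lt_min !divr_gt0// mulr_gt0// exprn_gt0.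
have t_tau : t < tau.
  by apply: (@le_lt_trans _ _ (tau / 2)); [rewrite ge_min lexx|lra].
have t_e : 4 * t <= e.
  by rewrite -ler_pdivlMl// mulrC !ge_min lexx orbT.
have t_r : 16 * t <= theta ^+ 2 * r.
  by rewrite -ler_pdivlMl// mulrC !ge_min lexx !orbT.
(* s is t for the ascent and - t for the descent *)
have step (s : R) : `|s| = t -> exists2 z, Mq z &
    [/\ enorm (z - x) <= (1 + theta) * t &
      forall v, `|dot (z - x) v - s * dot h v| <= theta * t * enorm v].
  move=> st; have [|z Mz zE] := tauP s; first by rewrite st tp.
  exists z => //; rewrite st in zE; split.
    rewrite -(subrK (s *: h) (z - x)) (le_trans (ler_enormD _ _))//.
    by rewrite enormZ st mulrDl mul1r addrC lerD// ler_piMr// ltW.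
  move=> v; rewrite -dotZl -dotBl (le_trans (normr_dot _ _))//.
  by rewrite ler_wpM2r ?enorm_ge0.
have small z : enorm (z - x) <= (1 + theta) * t -> enorm (z - x) < e.
  move=> zx; apply: le_lt_trans zx _; nra.
have steep z D : enorm (z - x) <= (1 + theta) * t -> t * (1 - 8 * theta) <= D ->
    enorm (z - x) <= C * D.
  move=> zx DP; rewrite -ler_pdivrMl// (le_trans _ DP)//.
  apply: le_trans (_ : C^-1 * ((1 + theta) * t) <= _); first by rewrite ler_wpM2l// ltW.
  by rewrite mulrA mulrC ler_wpM2l// ltW.
have tpos : 0 < t * (1 - 8 * theta) by rewrite mulr_gt0//; lra.
split.
- (* ascent: compare x and z through a point p that is nearest to z *)
  have [|z Mz [zx zv]] := step t; first by rewrite gtr0_norm.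
  have [p np] := nearest_exists z cMp Mp0; have [Mpp _] := np.
  have xp : enorm (x - p) <= r + 2 * (1 + theta) * t.
    have := ler_enorm_distD z x p; rewrite -(nearest_rdist np) (enormBC x z).
    have := rdist_leD cMp Mp0 z x; rewrite -/r; lra.
  have rxp : r <= enorm (x - p) by apply: rdist_le.
  have pp0 : enorm (p - p0) <= 3 * theta * r.
    rewrite dE; apply: normP; rewrite -?dE//.
    apply: (@le_trans _ _ ((r * (1 + theta ^+ 2 / 4)) ^+ 2)).
      rewrite lerXn2r ?nnegrE ?enorm_ge0//; first by nra.
      apply: le_trans xp _; nra.
    rewrite exprMn mulrC ler_wpM2r ?sqr_ge0//.
    have : theta ^+ 2 <= 1 by rewrite expr2; nra.
    have := sqr_ge0 theta; nra.
  have xp' : enorm (x - p) <= r * (1 + 3 * theta).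
    have := ler_enorm_distD p0 x p; rewrite -dE (enormBC p0 p); lra.
  have hp : (1 - 4 * theta) * r <= dot h (x - p).
    have -> : x - p = (x - p0) - (p - p0) by rewrite opprB addrA subrK.
    rewrite dotBr; rewrite -dE in hx.
    have := cauchy_schwarz h (p - p0); have := enorm_ge0 (p - p0); nra.
  have up : t * (1 - 8 * theta) <= rdist Mp z - r.
    have rp : 0 < enorm (x - p) by exact: lt_le_trans rxp.
    have := enorm_sub_ge z x p; rewrite -(nearest_rdist np).
    have := zv (x - p); rewrite ler_norml => /andP[zv1 _] zv2.
    have h3 : t * (1 - 8 * theta) * enorm (x - p) <= dot (z - x) (x - p).
      have : t * ((1 - 4 * theta) * r) <= t * dot h (x - p) by rewrite ler_wpM2l// ltW.
      have : t * ((1 - 7 * theta) * enorm (x - p)) <= t * ((1 - 4 * theta) * r).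
        rewrite ler_wpM2l ?(ltW tp)//.
        apply: le_trans (_ : (1 - 7 * theta) * (r * (1 + 3 * theta)) <= _).
          by rewrite ler_wpM2l//; lra.
        nra.
      lra.
    have : t * (1 - 8 * theta) <= rdist Mp z - enorm (x - p).
      by rewrite -(ler_pM2r rp) (le_trans h3)// mulrC.
    lra.
  exists z; split=> //; last exact: steep.
  have := rdist_leD cMp Mp0 z x; have := small z zx; rewrite -/r; lra.
- (* descent: compare x and z through the point p0 that is nearest to x *)
  have [|z Mz [zx zv]] := step (- t); first by rewrite normrN gtr0_norm.
  have down : t * (1 - 8 * theta) <= r - rdist Mp z.
    have zp : enorm (z - p0) <= r + (1 + theta) * t.
      have := ler_enorm_distD x z p0; rewrite -dE; lra.
    have zp' : 0 < enorm (z - p0).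
      have := ler_enorm_distD z x p0; rewrite -dE (enormBC x z).
      nra.
    have := enorm_sub_ge x z p0; rewrite -dE.
    have -> : dot (x - z) (z - p0) = - dot (z - x) (x - p0) - enorm (z - x) ^+ 2.
      have -> : x - z = - (z - x) by rewrite opprB.
      have -> : z - p0 = (z - x) + (x - p0) by rewrite subrKA.
      by rewrite dotNl dotDr enorm_sqr; ring.
    have := zv (x - p0); rewrite -dE ler_norml => /andP[_ zv1] zv2.
    have h3 : t * (1 - 8 * theta) * enorm (z - p0) <=
        - dot (z - x) (x - p0) - enorm (z - x) ^+ 2.
      have h4 : t * ((1 - theta) * r) <= t * dot h (x - p0).
        by rewrite ler_wpM2l ?(ltW tp)// dE.
      have h5 : enorm (z - x) ^+ 2 <= 4 * t ^+ 2.
        have -> : 4 * t ^+ 2 = (2 * t) ^+ 2 by ring.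
        by rewrite lerXn2r ?nnegrE ?enorm_ge0//; nra.
      have h6 : 4 * t ^+ 2 <= t * (theta * r).
        by rewrite expr2 mulrCA ler_wpM2l ?(ltW tp)//; nra.
      have h7 : t * ((1 - 8 * theta) * enorm (z - p0)) <= t * ((1 - 3 * theta) * r).
        rewrite ler_wpM2l ?(ltW tp)//.
        apply: le_trans (_ : (1 - 8 * theta) * (r * (1 + theta)) <= _).
          by rewrite ler_wpM2l//; nra.
        nra.
      lra.
    have : t * (1 - 8 * theta) <= r - enorm (z - p0).
      by rewrite -(ler_pM2r zp') (le_trans h3)// mulrC.
    have := rdist_le cMp Mp0 z Mp0'; lra.
  exists z; split=> //; last exact: steep.
  have := rdist_leD cMp Mp0 x z; have := small z zx; rewrite (enormBC x z) -/r; lra.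
Qed.

End slopes.

(** * Moving to a prescribed level of the distance *)

Section moving.
Variables (R : realType) (N : nat).
Implicit Types (X Mp : set 'rV[R]_N) (x y z p q : 'rV[R]_N).

(** An extremal point of [f], among the points that are reached from [x] at cost at
    most [C] per unit of [f], has to lie on the level [a]. *)
Lemma reach_level X (f : 'rV[R]_N -> R) (C a : R) x :
  continuous f -> X x -> f x <= a ->
  compact [set y | X y /\ f x <= f y <= a] ->
  (forall y, X y -> f x <= f y < a ->
    exists z, [/\ X z, f y < f z <= a & enorm (z - y) <= C * (f z - f y)]) ->
  exists z, [/\ X z, f z = a & enorm (z - x) <= C * (a - f x)].
Proof.
move=> fc Xx fxa cL up.
pose g y := enorm (y - x) - C * (f y - f x).
have gc : continuous g.
  move=> y; apply: (@cvgB _ _ _ (nbhs y) _ (fun y => enorm (y - x))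
    (fun y => C * (f y - f x))); first exact: enorm_continuous.
  by apply: cvgM; [exact: cvg_cst|apply: cvgB; [exact: fc|exact: cvg_cst]].
have cg : closed (g @^-1` [set t | t <= 0]).
  by apply: preimage_closed; [move=> y _; exact: gc|exact: closed_le].
have [|y] := EVT_max_rV _ (compact_closedI cL cg)
  (continuous_subspaceT (fun y => fc y)).
  exists x; split=> /=; first by rewrite lexx.
  by rewrite /g !subrr enorm0 mulr0 subr0.
rewrite inE => -[[Xy /andP[fxy fya]]]; rewrite /= /g subr_le0 => yx ymax.
have [fy|fy] := eqVneq (f y) a; first by exists y; rewrite fy in yx.
have [|z [Xz /andP[yz za] zy]] := up y Xy; first by rewrite fxy lt_neqAle fy.
have := ymax z; rewrite inE leNgt yz => /(_ _)/negP; case; split=> /=.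
  by rewrite za (le_trans fxy (ltW yz)).
rewrite /g subr_le0 (le_trans (ler_enorm_distD y _ _))//.
rewrite (le_trans (lerD zy yx))// le_eqVlt; apply/orP; left; apply/eqP; ring.
Qed.

(** Local closedness of [X] makes it closed in a neighbourhood of the compact set
    [Mp]. *)
Lemma compact_tube X Mp :
  locally_closed X -> compact Mp -> Mp !=set0 -> Mp `<=` X ->
  exists2 rho, 0 < rho & forall lo hi : R, hi < rho ->
    compact [set y | X y /\ lo <= rdist Mp y <= hi].
Proof.
move=> [U [F [oU cF ->]]] cMp Mp0 MpX.
pose Q (rho : R) p := forall y, enorm (y - p) < rho -> U y.
have /compact_near_coveringP := cMp.
move=> /(_ R (0 : R)^'+ Q _)[|rho [rho0 MQ]].
- move=> p /MpX[Up _].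
  have : \forall y \near p, U y by exact: open_nbhs_nbhs.
  move=> /nbhs_ballP[d /= d0 dU].
  have d20 : 0 < d / 2 by rewrite divr_gt0.
  exists (ball p (d / 2), [set r : R | r < d / 2]) => /=.
    by split; [exact: nbhsx_ballx|exact: nbhs_right_lt].
  move=> -[q r] /= [pq rd] y yq; apply: dU; move: pq; rewrite -ball_normE/= => pq.
  rewrite -(subrKA q) (le_lt_trans (ler_normD _ _))// [d]splitr ltrD//.
  by rewrite distrC (le_lt_trans (normr_le_enorm _))// (lt_trans yq).
have r20 : 0 < rho / 2 by rewrite divr_gt0.
exists (rho / 2) => // lo hi hirho.
have -> : [set y | (U `&` F) y /\ lo <= rdist Mp y <= hi] =
    F `&` (rdist Mp @^-1` [set t | lo <= t] `&` rdist Mp @^-1` [set t | t <= hi]).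
  apply/seteqP; split=> y /=; first by case=> -[_ Fy] /andP[].
  case=> Fy [ly yh]; split; last by rewrite ly.
  split=> //; have [p np] := nearest_exists y cMp Mp0.
  have Q2 : Mp `<=` Q (rho / 2).
    apply: MQ => //=; rewrite sub0r normrN gtr0_norm//.
    by rewrite ltr_pdivrMr// ltr_pMr// ltr1n.
  by apply: (Q2 p np.1); rewrite -(nearest_rdist np) (le_lt_trans yh).
have dc := rdist_continuous cMp Mp0.
apply: bounded_closed_compact; last first.
  apply: closedI => //; apply: closedI.
    by apply: preimage_closed; [move=> y _; exact: dc|exact: closed_ge].
  by apply: preimage_closed; [move=> y _; exact: dc|exact: closed_le].
have [B [_ MB]] := compact_bounded cMp.
exists (hi + (B + 1)); split; first exact: num_real.
move=> B' BB' y [_ [_ /= yh]]; have [p np] := nearest_exists y cMp Mp0.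
rewrite -(subrK p y) (le_trans (ler_normD _ _))// (le_trans _ (ltW BB'))//.
rewrite lerD//; last by apply: MB np.1; rewrite ltrDl.
by rewrite (le_trans (normr_le_enorm _))// -(nearest_rdist np).
Qed.

(** [reach_level] is applied to the distance for the ascent, and to its opposite for
    the descent. *)
Lemma whitney_reach (W : sam R N) (C : R) :
  whitney_stratified W -> compact (sam_p W) -> sam_p W !=set0 -> 1 < C ->
  exists2 rho, 0 < rho & forall x (a : R), sam_X W x ->
    0 < rdist (sam_p W) x < rho -> 0 < a < rho ->
    exists z, [/\ sam_X W z, rdist (sam_p W) z = a
      & enorm (z - x) <= C * `|rdist (sam_p W) x - a|].
Proof.
move=> [lcX _ _ [sMp sMq] whb] cMp Mp0 C1; set d := rdist _.
have [rho1 rho10 slopeP] := whitney_slopes sMp sMq cMp Mp0 whb C1.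
have [rho2 rho20 cX] := compact_tube lcX cMp Mp0 (@sam_pX _ _ W).
have dc : continuous d := rdist_continuous cMp Mp0.
have qP y : sam_X W y -> 0 < d y -> sam_q W y.
  by move=> Xy dy; split=> // py; move: dy; rewrite /d rdist_mem// ltxx.
exists (Num.min rho1 rho2) => [|x a Xx]; first by rewrite lt_min rho10.
rewrite !lt_min => /andP[x0 /andP[x1 x2]] /andP[a0 /andP[a1 a2]].
have [xa|ax] := leP (d x) a.
- rewrite distrC ger0_norm ?subr_ge0//.
  apply: (reach_level dc Xx xa (cX _ _ a2)) => y Xy /andP[xy ya].
  have y0 : 0 < d y by exact: lt_le_trans xy.
  have [||[z [Mz /andP[yz za] zy]] _] := slopeP y (a - d y) (qP y Xy y0).
  + by rewrite y0/= (lt_trans ya).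
  + by rewrite subr_gt0.
  exists z; split=> //; first by case: Mz.
  by rewrite yz/=; rewrite subrKC in za; exact: ltW.
- rewrite gtr0_norm ?subr_gt0//.
  have dNc : continuous (fun y => - d y).
    by move=> y; apply: (@cvgN _ _ _ (nbhs y)); exact: dc.
  have xa : - d x <= - a by rewrite lerN2 ltW.
  have [||z [Xz /oppr_inj dz zx]] := @reach_level _ _ C _ _ dNc Xx xa.
  + have := cX a (d x) x2; congr compact; apply/seteqP; split=> y /=.
      by case=> Xy /andP[ay yx]; rewrite !lerN2 ay yx.
    by rewrite !lerN2 => -[Xy /andP[yx ay]]; rewrite ay yx.
  + move=> y Xy; rewrite lerN2 ltrN2 => /andP[yx ay].
    have y0 : 0 < d y by exact: lt_trans ay.
    have [||_ [z [Mz /andP[yz za] zy]]] := slopeP y (d y - a) (qP y Xy y0).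
    * by rewrite y0/= (le_lt_trans yx).
    * by rewrite subr_gt0.
    exists z; split; first by case: Mz.
      by rewrite ltrN2 lerN2 za/=; rewrite subKr in yz; exact: ltW.
    by rewrite opprK [- d z + _]addrC.
  by exists z; split=> //; move: zx; rewrite opprK [- a + _]addrC.
Qed.

End moving.

(** * Strata functions of nearby samples *)

Section samples.
Variables (R : realType) (N : nat).
Implicit Types (S T W : sam R N) (x y z : 'rV[R]_N).

Definition sfun S x : R := fine (strat_fun S x).

Lemma strat_funE S x : strat_fun S x = (sfun S x)%:E.
Proof.
rewrite /sfun fineK// fin_numElt (lt_le_trans _ (strat_fun_ge0 S x))//=.
by rewrite (le_lt_trans (strat_fun_le1 S x)) ?ltry.
Qed.

Lemma sfun_ge0 S x : 0 <= sfun S x.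
Proof. by rewrite -lee_fin -strat_funE strat_fun_ge0. Qed.

Lemma sfun_le1 S x : sfun S x <= 1.
Proof. by rewrite -lee_fin -strat_funE strat_fun_le1. Qed.

Lemma sub_betweenE S (a b : R) x :
  sub_between S a b x <-> sam_X S x /\ a <= sfun S x <= b.
Proof. by rewrite /sub_between /= strat_funE !lee_fin. Qed.

Lemma dist_set_perturb (A B : set 'rV[R]_N) (eps : R) x y :
  A `<=` thicken B eps -> enorm (x - y) <= eps ->
  (dist_set y B <= dist_set x A + (2 * eps)%:E)%E.
Proof.
move=> AB xy; rewrite -leeBlDr//; apply: le_ereal_inf_tmp => _ [q Aq <-].
have [q' Bq' qq'] := AB q Aq; rewrite leeBlDr// -EFinD.
apply: le_trans (_ : (enorm (y - q'))%:E <= _)%E.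
  by apply: ereal_inf_lbound; exists q'.
rewrite lee_fin; have := ler_enorm_distD x y q'; have := ler_enorm_distD q x q'.
rewrite (enormBC y x) (enormBC q q'); lra.
Qed.

Lemma sfun_perturb S T (eps : R) x y : 0 <= eps ->
  sam_p S `<=` thicken (sam_p T) eps -> enorm (x - y) <= eps ->
  sfun T y <= sfun S x + 2 * eps.
Proof.
move=> eps0 ST xy; rewrite -lee_fin EFinD -!strat_funE -leeBlDr//.
rewrite [strat_fun S x]/strat_fun le_min !leeBlDr//; apply/andP; split.
  by apply: le_trans (dist_set_perturb ST xy); rewrite /strat_fun ge_min lexx.
apply: (le_trans (strat_fun_le1 T y)).
by rewrite -EFinD lee_fin lerDl mulr_ge0.
Qed.

Lemma whitney_move W (C : R) :
  whitney_stratified W -> compact (sam_p W) -> 1 < C ->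
  exists2 rho, 0 < rho <= 1 & forall x (a : R), sam_X W x ->
    0 < sfun W x < rho -> 0 < a < rho ->
    exists z, [/\ sam_X W z, sfun W z = a
      & enorm (z - x) <= C * `|sfun W x - a|].
Proof.
move=> whW cWp C1; have [Wp0|Wp0] := pselect (sam_p W !=set0); last first.
  (* the stratum function is constantly 1 *)
  exists 1 => [|x a Xx]; first by rewrite ltr01 lexx.
  suff -> : sfun W x = 1 by rewrite ltxx andbF.
  rewrite /sfun /strat_fun /dist_set.
  have -> : sam_p W = set0 by apply/seteqP; split=> // p Wp; case: Wp0; exists p.
  by rewrite image_set0 ereal_inf0 /mine.
have [rho rho0 reach] := whitney_reach whW cWp Wp0 C1.
have sE x : sfun W x = Num.min (rdist (sam_p W) x) 1.
  by rewrite /sfun /strat_fun (dist_setE cWp Wp0) -EFin_min.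
have sd x (c : R) : c < 1 -> (sfun W x = c) <-> (rdist (sam_p W) x = c).
  move=> c1; rewrite sE; split=> [cE|->]; last by rewrite min_l// ltW.
  have [d1|d1] := leP (rdist (sam_p W) x) 1; first by rewrite min_l in cE.
  by move: c1; rewrite -cE min_r ?ltxx// ltW.
exists (Num.min rho 1) => [|x a Xx]; first by rewrite lt_min rho0 ltr01 ge_min lexx orbT.
rewrite !lt_min => /andP[x0 /andP[xr x1]] /andP[a0 /andP[ar a1]].
have dx := (sd x _ x1).1 erefl; rewrite -dx in x0 xr *.
have [||z [Xz za zx]] := reach x a Xx; rewrite ?x0 ?a0//.
by exists z; split=> //; exact/(sd z _ a1).
Qed.

(** The two bounds on [s] are independent of each other: a bound below [0] or above
    [1] is void, and the other ones have to lie in the range where [W] has points at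
    every level nearby. *)
Lemma whitney_clamp W (C rho eps a b : R) x :
  (forall x (a : R), sam_X W x -> 0 < sfun W x < rho -> 0 < a < rho ->
    exists z, [/\ sam_X W z, sfun W z = a
      & enorm (z - x) <= C * `|sfun W x - a|]) ->
  0 <= C -> 0 <= eps -> a <= b ->
  a <= 0 \/ 2 * eps < a < rho -> 1 <= b \/ 0 < b < rho - 2 * eps ->
  sam_X W x -> a - 2 * eps <= sfun W x <= b + 2 * eps ->
  exists z, [/\ sam_X W z, a <= sfun W z <= b & enorm (z - x) <= C * (2 * eps)].
Proof.
move=> move_to C0 e0 ab aP bP Xx /andP[ax xb].
have [xa|{}ax] := ltP (sfun W x) a.
  case: aP => [a0|/andP[a0 ar]].
    by move: xa; rewrite ltNge (le_trans a0 (sfun_ge0 W x)).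
  have [||z [Xz za zx]] := move_to x a Xx.
  - by apply/andP; split; lra.
  - by apply/andP; split; lra.
  exists z; rewrite za lexx ab; split=> //; rewrite (le_trans zx)//.
  by rewrite ler_wpM2l// ler0_norm; lra.
have [bx|{}xb] := ltP b (sfun W x).
  case: bP => [b1|/andP[b0 br]].
    by move: bx; rewrite ltNge (le_trans (sfun_le1 W x) b1).
  have [||z [Xz za zx]] := move_to x b Xx.
  - by apply/andP; split; lra.
  - by apply/andP; split; lra.
  exists z; rewrite za lexx ab; split=> //; rewrite (le_trans zx)//.
  by rewrite ler_wpM2l// ger0_norm; lra.
exists x; rewrite ax xb subrr enorm0; split=> //.
by rewrite !mulr_ge0.
Qed.

End samples.

(** * Sublevel and superlevel sets of nearby samples *)

Section thickenings.
Variables (R : realType) (N : nat).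
Implicit Types (A B : set 'rV[R]_N) (S W : sam R N).

Lemma thicken_thicken A B (a e : R) :
  A `<=` thicken B e -> thicken A a `<=` thicken B (a + e).
Proof.
move=> AB y [x /AB[z Bz zx] xy]; exists z => //.
by rewrite (le_trans (ler_enorm_distD x _ _))// addrC lerD.
Qed.

Lemma hausdorff_dist_ge0 A B : (0 <= hausdorff_dist A B)%E.
Proof.
by apply: le_ereal_inf_tmp => _ [a [a0 _ _] <-]; rewrite lee_fin ltW.
Qed.

Lemma hausdorff_dist_lt A B (e : R) : (hausdorff_dist A B < e%:E)%E ->
  A `<=` thicken B e /\ B `<=` thicken A e.
Proof.
move=> /ereal_inf_lt[_ [a [_ AB BA] <-]]; rewrite lte_fin => ae.
by split=> x => [/AB|/BA]; exact: (thicken_sub (@subset_refl _ _) (ltW ae)).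
Qed.

(** A point of [W] is first moved into the slightly smaller range from [a'] to [b'],
    which leaves room for the error made in passing to [S]. *)
Lemma sub_between_thicken S W (C rho eps a b a' b' : R) :
  (forall x (a : R), sam_X W x -> 0 < sfun W x < rho -> 0 < a < rho ->
    exists z, [/\ sam_X W z, sfun W z = a
      & enorm (z - x) <= C * `|sfun W x - a|]) ->
  0 <= C -> 0 <= eps -> sam_X W `<=` thicken (sam_X S) eps ->
  sam_X S `<=` thicken (sam_X W) eps -> sam_p W `<=` thicken (sam_p S) eps ->
  sam_p S `<=` thicken (sam_p W) eps -> a <= b -> a' <= b' ->
  (a <= 0 /\ a' <= 0) \/ (2 * eps < a /\ a' = a + 2 * eps /\ a' < rho) ->
  (1 <= b /\ 1 <= b') \/
    (0 < b' /\ b' = b - 2 * eps /\ b < rho - 2 * eps) ->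
  sub_between W a b `<=` thicken (sub_between S a b) ((2 * C + 1) * eps) /\
  sub_between S a b `<=` thicken (sub_between W a b) ((2 * C + 1) * eps).
Proof.
move=> move_to C0 e0 WS SW WSp SWp ab ab' aP bP; split.
- move=> x /sub_betweenE[Xx /andP[ax xb]].
  have [|||z [Xz /andP[az zb] zx]] :=
      @whitney_clamp R N W C rho eps a' b' x move_to C0 e0 ab' _ _ Xx.
  + by case: aP => [[_ ->]|[? [-> ?]]]; [left|right; apply/andP; split; lra].
  + by case: bP => [[_ ->]|[? [bE ?]]]; [left|right; apply/andP; split; lra].
  + have := sfun_ge0 W x; have := sfun_le1 W x => x1 x0.
    by apply/andP; split; [case: aP => [[? ?]|[? [? ?]]]|
      case: bP => [[? ?]|[? [? ?]]]]; lra.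
  have [y Sy yz] := WS z Xz; exists y.
    apply/sub_betweenE; split=> //.
    have zy := sfun_perturb e0 WSp (_ : enorm (z - y) <= eps).
    have := sfun_perturb e0 SWp yz; rewrite enormBC in yz; have := zy yz.
    have := sfun_ge0 S y; have := sfun_le1 S y => *.
    by apply/andP; split; [case: aP => [[? ?]|[? [? ?]]]|
      case: bP => [[? ?]|[? [? ?]]]]; lra.
  have := ler_enorm_distD z y x; lra.
- move=> x /sub_betweenE[Xx /andP[ax xb]].
  have [y Wy yx] := SW x Xx.
  have [|||z [Xz abz zy]] :=
      @whitney_clamp R N W C rho eps a b y move_to C0 e0 ab _ _ Wy.
  + by case: aP => [[? _]|[? [? ?]]]; [left|right; apply/andP; split; lra].
  + by case: bP => [[? _]|[? [? ?]]]; [left|right; apply/andP; split; lra].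
  + have := sfun_perturb e0 WSp yx; rewrite enormBC in yx.
    have := sfun_perturb e0 SWp yx => *; apply/andP; split; lra.
  exists z; first exact/sub_betweenE.
  by have := ler_enorm_distD y z x; lra.
Qed.

End thickenings.

(** * Interleavings induced by inclusions *)

(** On the classes of morphisms of [D] the functor induced on the localization is
    [F] itself, so that relations between morphisms of [D] descend. *)
Lemma loc_interleaving (D : category) (V : forall x y : D, Defs.hom x y -> Prop)
    (F : functor D D)
    (FV : forall (x y : D) (f : Defs.hom x y), V x y f -> V (F x) (F y) (Defs.fmap F f))
    (x y : D) (f : Defs.hom x (F y)) (g : Defs.hom y (F x))
    (hx : Defs.hom x (F (F x))) (hy : Defs.hom y (F (F y))) :
  compm (Defs.fmap F g) f = hx -> compm (Defs.fmap F f) g = hy ->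
  exists (f' : @Defs.hom (localization V) x (localization_map FV y))
    (g' : @Defs.hom (localization V) y (localization_map FV x)),
    compm (Defs.fmap (localization_map FV) g') f' = Defs.fmap (loc V) hx /\
    compm (Defs.fmap (localization_map FV) f') g' = Defs.fmap (loc V) hy.
Proof.
have comp z t (u : Defs.hom z (F t)) (w : Defs.hom t (F z)) :
    lcomp (lclass (word_map FV (lrepr (lclass (wfwd V w))))) (lclass (wfwd V u)) =
    lclass (wfwd V (compm (Defs.fmap F w) u)).
  rewrite lcompE; apply/lclassP; apply: weq_trans _ (weq_sym (weq_fwdM V _ _)).
  apply: weq_comp; last exact: weq_refl.
  exact: (word_map_eq FV (lreprP (wfwd V w))).
by move=> <- <-; exists (lclass (wfwd V f)), (lclass (wfwd V g)); split; exact: comp.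
Qed.

Section interleavings.
Variable R : realType.

Lemma interleaved_strict (e : {nonneg R}) (Y Z : pdiag R)
    (f : @Defs.hom (pdiag R) Y (pshift e Z)) (g : @Defs.hom (pdiag R) Z (pshift e Y)) :
  compm (Defs.fmap (pshift e) g) f = pshift2_map e Y ->
  compm (Defs.fmap (pshift e) f) g = pshift2_map e Z ->
  interleaved e (Y : hopdiag R) (Z : hopdiag R).
Proof. exact: (@loc_interleaving (pdiag R) (@pdiag_weq R) _ (@pshift_weq R e)). Qed.

Variables (N : nat) (v : R * R) (e : {nonneg R}).
Implicit Types S T : sam R N.

Section shift.
Variables S T : sam R N.
Hypotheses (Sp : sub_le S v.2 `<=` thicken (sub_le T v.2) e%:num)
  (Spq : sub_between S v.1 v.2 `<=` thicken (sub_between T v.1 v.2) e%:num)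
  (Sq : sub_ge S v.1 `<=` thicken (sub_ge T v.1) e%:num).

Definition strat_diagram_shift_at (a : {nonneg R}) :
  diagram_hom (strat_diagram v S a) (strat_diagram v T (a%:num + e%:num)%:nng).
Proof.
unshelve refine (@DiagramHom R (strat_diagram v S a)
  (strat_diagram v T (a%:num + e%:num)%:nng)
  (Defs.incl (thicken_thicken (a := a%:num) Sp))
  (Defs.incl (thicken_thicken (a := a%:num) Spq))
  (Defs.incl (thicken_thicken (a := a%:num) Sq)) _ _).
- by apply/continuousEP => x; exact: val_inj.
- by apply/continuousEP => x; exact: val_inj.
Defined.

Definition strat_diagram_shift :
  @Defs.hom (pdiag R) (persistent_strat v S) (pshift e (persistent_strat v T)).
Proof.
exists strat_diagram_shift_at => a b ab.
by apply: diagram_homP; apply/continuousEP => x; exact: val_inj.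
Defined.

End shift.

(** All maps are inclusions of subsets of the same space, so that the triangles of
    the interleaving commute before passing to the homotopy category. *)
Lemma interleaved_thicken S T :
  sub_le S v.2 `<=` thicken (sub_le T v.2) e%:num ->
  sub_le T v.2 `<=` thicken (sub_le S v.2) e%:num ->
  sub_between S v.1 v.2 `<=` thicken (sub_between T v.1 v.2) e%:num ->
  sub_between T v.1 v.2 `<=` thicken (sub_between S v.1 v.2) e%:num ->
  sub_ge S v.1 `<=` thicken (sub_ge T v.1) e%:num ->
  sub_ge T v.1 `<=` thicken (sub_ge S v.1) e%:num ->
  interleaved e (persistent_strat v S) (persistent_strat v T).
Proof.
move=> Sp Tp Spq Tpq Sq Tq.
apply: (interleaved_strict (f := strat_diagram_shift Sp Spq Sq)
  (g := strat_diagram_shift Tp Tpq Tq)).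
- by apply: nattransP => a; apply: diagram_homP; apply/continuousEP => x;
    exact: val_inj.
- by apply: nattransP => a; apply: diagram_homP; apply/continuousEP => x;
    exact: val_inj.
Qed.

End interleavings.

Theorem theorem3p46 (R : realType) (N : nat) (W : sam R N)
    (whitneyW : whitney_stratified W) (compactWp : compact (sam_p W))
    (C : R) (C_gt1 : 1 < C) :
  exists2 r : R, 0 < r &
    forall v : R * R, Omega v -> 0 < v.1 < r -> 0 < v.2 < r ->
      lipschitz_at (@sam_dist R N) (@interleaving_dist R) (2 * (C + 1))
        (@persistent_strat R N v) W.
Proof.
have [rho /andP[rho0 rho1] move_to] := whitney_move whitneyW compactWp C_gt1.
exists rho => // -[vl vu] [/= vl0 vlu vu1] /andP[_ vlr] /andP[vu0 vur].
pose d0 := Num.min (vl / 2) (Num.min ((rho - vu) / 2) ((vu - vl) / 4)).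
have d00 : 0 < d0 by rewrite !lt_min !divr_gt0// subr_gt0.
have C0 : 0 <= C by rewrite (le_trans ler01)// ltW.
(* an error of 2 eps at both ends of the range from vl to vu has to leave a
   nonempty range inside the one from 0 to rho *)
have close S (eps : R) : (sam_dist W S < eps%:E)%E -> 0 < eps < d0 ->
    (interleaving_dist (persistent_strat (vl, vu) W) (persistent_strat (vl, vu) S)
      <= ((2 * C + 1) * eps)%:E)%E.
  rewrite /sam_dist gt_max => /andP[/hausdorff_dist_lt[WS SW]].
  move=> /hausdorff_dist_lt[WSp SWp] /andP[e0]; rewrite !lt_min.
  move=> /andP[e1 /andP[e2 e3]].
  have E0 : 0 <= (2 * C + 1) * eps by rewrite mulr_ge0 ?addr_ge0 ?mulr_ge0// ltW.
  apply: ereal_inf_lbound; exists (NngNum E0) => //=.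
  have thick a b a' b' := @sub_between_thicken R N S W C rho eps a b a' b' move_to C0
    (ltW e0) WS SW WSp SWp.
  have [le1 le2] : sub_le W vu `<=` thicken (sub_le S vu) ((2 * C + 1) * eps) /\
      sub_le S vu `<=` thicken (sub_le W vu) ((2 * C + 1) * eps).
    by apply: (thick 0 vu 0 (vu - 2 * eps)); [lra|lra|left|right; split; [|split]]; lra.
  have [ge1 ge2] : sub_ge W vl `<=` thicken (sub_ge S vl) ((2 * C + 1) * eps) /\
      sub_ge S vl `<=` thicken (sub_ge W vl) ((2 * C + 1) * eps).
    by apply: (thick vl 1 (vl + 2 * eps) 1); [lra|lra|right; split; [|split]|left]; lra.
  have [||||bt1 bt2] := thick vl vu (vl + 2 * eps) (vu - 2 * eps).
  - lra.
  - lra.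
  - by right; split; [|split]; lra.
  - by right; split; [|split]; lra.
  exact: interleaved_thicken.
exists (d0 / 2) => [|S WS]; first by rewrite divr_gt0.
have D0 : (0 <= sam_dist W S)%E by rewrite le_max hausdorff_dist_ge0.
case DE : (sam_dist W S) WS D0 => [d| |]; rewrite ?lee_fin// => dd d_ge0.
apply/lee_addgt0Pr => eta eta0.
have CC0 : 0 < 2 * C + 1 by rewrite ltr_wpDl// mulr_ge0.
(* eps exceeds the distance by a small amount, as close needs a strict inequality *)
pose eps := d + Num.min (eta / (2 * C + 1)) (d0 / 4).
have m0 : 0 < Num.min (eta / (2 * C + 1)) (d0 / 4) by rewrite lt_min !divr_gt0.
have eps_d0 : eps < d0.
  have : Num.min (eta / (2 * C + 1)) (d0 / 4) <= d0 / 4 by rewrite ge_min lexx orbT.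
  by rewrite /eps; lra.
have eps_eta : (2 * C + 1) * (eps - d) <= eta.
  by rewrite /eps [d + _]addrC addrK mulrC -ler_pdivlMr// ge_min lexx.
apply: (le_trans (close S eps _ _)).
- by rewrite DE lte_fin /eps ltrDl.
- by rewrite eps_d0 andbT /eps ltr_wpDl.
by rewrite -EFinM -EFinD lee_fin; lra.
Qed.
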